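(* Let $d\ge1$ and let $G_1,\dots,G_d$ be finite simple connected graphs with total orders on their vertex sets, and $\mathscr G=G_1\times\dots\times G_d$ with its induced simplicial structure. For any non-negative integer $k$, there is an isomorphism of abelian groups $$\mathrm{Chow}_{\mathrm{GS}}^{k+1}(\mathscr G)\;\simeq\;\mathbb Z\langle\mathscr G_k^{nd}\rangle\,/\,\mathscr I_k^{nd},$$ induced by the inclusion of $\mathbb Z\langle\mathscr G_k^{nd}\rangle$ in the degree $k+1$ part of $\mathbb Z[C_{\mathbf v}\mid \mathbf v\in\mathscr G_0]$.
   Context: **Simplicial structure.** Write $G_i=(V_i,E_i)$ with total order $\leq_i$ on $V_i$. The vertex set of $\mathscr G$ is $\mathscr G_0=V_1\times\dots\times V_d$, with $\mathbf u\le\mathbf v$ iff $u_i\leq_i v_i$ for all $i$. A 1-simplex is a pair $\mathbf u\le\mathbf v$ such that for each $i$ either $u_i=v_i$ or $\{u_i,v_i\}\in E_i$; put $I(\mathbf u,\mathbf v)=\{i:u_i<_iv_i\}$. A $k$-simplex is a sequence $\mathbf v_0\le\dots\le\mathbf v_k$ such that each consecutive pair is a 1-simplex and the sets $I(\mathbf v_j,\mathbf v_{j+1})$ are pairwise disjoint; it is non-degenerate if $\mathbf v_0<\dots<\mathbf v_k$. $\mathscr G_k^{nd}$ is the set of non-degenerate $k$-simplices. Vertices (possibly repeated) ''form a simplex'' if they can be ordered into a simplex. **Chow ring.** $Z(\mathscr G)=\mathbb Z[C_{\mathbf v}\mid\mathbf v\in\mathscr G_0]$, graded with $\deg C_{\mathbf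 v}=1$. The ideal $\mathscr I_{\mathrm{rat}}$ is generated by: (R1) $C_{\mathbf v_1}\cdots C_{\mathbf v_k}$ whenever $\mathbf v_1,\dots,\mathbf v_k$ do not form a simplex; (R2) $C_{\mathbf u}\sum_{\mathbf v\in\mathscr G_0}C_{\mathbf v}$ for $\mathbf u\in\mathscr G_0$; (R3) $C_{\mathbf u}C_{\mathbf w}\sum_{\mathbf v\in\mathscr G_0:\,v_i=u_i}C_{\mathbf v}$ for $\mathbf u,\mathbf w\in\mathscr G_0$ and $1\le i\le d$ with $u_i\neq w_i$. $\mathrm{Chow}_{\mathrm{GS}}(\mathscr G)=Z(\mathscr G)/\mathscr I_{\mathrm{rat}}$ and $\mathrm{Chow}^{m}_{\mathrm{GS}}(\mathscr G)$ is its degree $m$ part. **The module $\mathbb Z\langle\mathscr G_k^{nd}\rangle$ and the submodule $\mathscr I_k^{nd}$.** For a simplex $\sigma$ let $C_\sigma=\prod_{\mathbf v\in\sigma}C_{\mathbf v}$ (with multiplicity). $\mathbb Z\langle\mathscr G_k^{nd}\rangle$ is the $\mathbb Z$-submodule of $Z(\mathscr G)$ generated by the $C_\sigma$, $\sigma\in\mathscr G_k^{nd}$. For a 1-simplex $\mathbf u<\mathbf v$ let $\mathbf e_{\mathbf u,\mathbf v}=\prod_{i=1}^d\{u_i,v_i\}\subseteq\mathscr G_0$. For a non-degenerate simplex $\sigma$ with vertices $\mathbf u_0<\dots<\mathbf u_{r}$, an index $0\le t\le r-1$ and $i,j\in I(\mathbf u_t,\mathbf u_{t+1})$, let $$\widetilde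 R_{\sigma,i,j}=\sum_{\mathbf w\in\mathbf e_{\mathbf u_t,\mathbf u_{t+1}},\ w_i=u_{t,i}}C_{\mathbf w}\;-\sum_{\mathbf w\in\mathbf e_{\mathbf u_t,\mathbf u_{t+1}},\ w_j=u_{t,j}}C_{\mathbf w},$$ where $u_{t,i}$ is the $i$-th coordinate of $\mathbf u_t$. If $\sigma\in\mathscr G_{k-1}^{nd}$, then $C_\sigma\widetilde R_{\sigma,i,j}\in\mathbb Z\langle\mathscr G_k^{nd}\rangle$. $\mathscr I_k^{nd}$ is the $\mathbb Z$-submodule of $\mathbb Z\langle\mathscr G_k^{nd}\rangle$ generated by all $C_\sigma\widetilde R_{\sigma,i,j}$ with $\sigma\in\mathscr G_{k-1}^{nd}$ and $i,j$ lying in a common set $I(\mathbf u_t,\mathbf u_{t+1})$ (so it is $0$ for $k=0,1$). *)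

(* Defs.v *)
From HB Require Import structures.
From mathcomp Require Import all_boot all_order all_algebra.
From mathcomp Require Import ring_quotient boolp mpoly.

Set Implicit Arguments.
Unset Strict Implicit.
Unset Printing Implicit Defensive.

Import Order.TTheory GRing.Theory.
Local Open Scope ring_scope.
Local Open Scope quotient_scope.

(* Generated ideals and subgroups, as boolean predicates (through the classical
   reflection `[< _ >]), so that the quotients of ring_quotient apply. *)
Definition ideal_span (R : comNzRingType) (S : R -> Prop) : {pred R} :=
  fun x => `[< exists s : seq (R * R),
    (forall p, p \in s -> S p.2) /\ x = \sum_(p <- s) p.1 * p.2 >].

Definition zspan (M : zmodType) (S : M -> Prop) : {pred M} :=
  fun x => `[< exists s : seq (int * M),
    (forall p, p \in s -> S p.2) /\ x = \sum_(p <- s) p.2 *~ p.1 >].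

Lemma ideal_spanP (R : comNzRingType) (S : R -> Prop) (x : R) :
  reflect (exists s : seq (R * R),
    (forall p, p \in s -> S p.2) /\ x = \sum_(p <- s) p.1 * p.2)
    (x \in ideal_span S).
Proof. exact: asboolP. Qed.

Lemma zspanP (M : zmodType) (S : M -> Prop) (x : M) :
  reflect (exists s : seq (int * M),
    (forall p, p \in s -> S p.2) /\ x = \sum_(p <- s) p.2 *~ p.1)
    (x \in zspan S).
Proof. exact: asboolP. Qed.

Lemma ideal_span_zmod (R : comNzRingType) (S : R -> Prop) :
  zmod_closed (ideal_span S).
Proof.
split; first by apply/ideal_spanP; exists [::]; rewrite big_nil.
move=> _ _ /ideal_spanP[s [sS ->]] /ideal_spanP[t [tS ->]]; apply/ideal_spanP.
exists (s ++ [seq (- p.1, p.2) | p <- t]); split.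
  move=> p; rewrite mem_cat => /orP[/sS//|/mapP[q /tS qS ->]//].
rewrite big_cat big_map /=; congr (_ + _); rewrite -sumrN.
by apply: eq_bigr => p _; rewrite mulNr.
Qed.

Lemma ideal_span_mul (R : comNzRingType) (S : R -> Prop) (a x : R) :
  x \in ideal_span S -> a * x \in ideal_span S.
Proof.
move=> /ideal_spanP[s [sS ->]]; apply/ideal_spanP.
exists [seq (a * p.1, p.2) | p <- s]; split; first by move=> p /mapP[q /sS ? ->].
by rewrite big_map mulr_sumr; apply: eq_bigr => p _; rewrite mulrA.
Qed.

Lemma zspan_zmod (M : zmodType) (S : M -> Prop) : zmod_closed (zspan S).
Proof.
split; first by apply/zspanP; exists [::]; rewrite big_nil.
move=> _ _ /zspanP[s [sS ->]] /zspanP[t [tS ->]]; apply/zspanP.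
exists (s ++ [seq (- p.1, p.2) | p <- t]); split.
  move=> p; rewrite mem_cat => /orP[/sS//|/mapP[q /tS qS ->]//].
rewrite big_cat big_map /=; congr (_ + _); rewrite -sumrN.
by apply: eq_bigr => p _; rewrite mulrNz.
Qed.

HB.instance Definition _ (M : zmodType) (S : M -> Prop) :=
  GRing.isZmodClosed.Build M (zspan S) (zspan_zmod S).

Lemma zspan_gen (M : zmodType) (S : M -> Prop) (x : M) :
  S x -> x \in zspan S.
Proof.
move=> Sx; apply/zspanP; exists [:: (1, x)].
by split=> [p|]; rewrite ?inE ?big_seq1 // => /eqP->.
Qed.

Lemma pairwise_disjoint_split (T : finType) (L1 L2 : seq {set T}) (D A B : {set T}) :
    A \subset D -> B \subset D -> [disjoint A & B] ->
    pairwise (fun X Y : {set T} => [disjoint X & Y]) (L1 ++ D :: L2) ->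
  pairwise (fun X Y : {set T} => [disjoint X & Y]) (L1 ++ [:: A, B & L2]).
Proof.
move=> AD BD AB; rewrite !pairwise_cat /= !allrel_consr AB /=.
case/andP=> /andP[/allP L1D ->] /andP[-> /andP[/allP DL2 ->]].
have DS (X : {set T}) : X \subset D -> all (fun Y : {set T} => [disjoint X & Y]) L2.
  by move=> XD; apply/allP => Y /DL2 DY; exact: (disjointWl XD DY).
have LS (X : {set T}) : X \subset D -> all (fun Y : {set T} => [disjoint Y & X]) L1.
  by move=> XD; apply/allP => Y /L1D DY; exact: (disjointWr XD DY).
by rewrite !DS ?LS.
Qed.

(* A connected graph is nonempty. *)
Definition simple_connected_graph (V : finType) (E : rel V) : Prop :=
  [/\ ssrbool.symmetric E, irreflexive E, (0 < #|V|)%N & forall x y, connect E x y].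

Section ProductGraph.

Variables (d : nat) (disp : Order.disp_t).
Variables (V : 'I_d -> finOrderType disp) (E : forall i, rel (V i)).

Definition vertex : finType := {dffun forall i : 'I_d, V i}.

Implicit Types (u v w : vertex) (s : seq vertex).

Definition vle u v : bool := [forall i, (u i <= v i)%O].

Definition vlt u v : bool := (u != v) && vle u v.

Definition simplex1 u v : bool :=
  vle u v && [forall i, (u i == v i) || E (u i) (v i)].

Definition dirs u v : {set 'I_d} := [set i | (u i < v i)%O].

(* pairmap dirs v s' lists the sets I(v_j, v_{j+1}) along v :: s'. *)
Definition simplex s : bool :=
  if s is v :: s' then
    path simplex1 v s' &&
    pairwise (fun A B : {set 'I_d} => [disjoint A & B]) (pairmap dirs v s')
  else false.

Definition nd_simplex (k : nat) s : bool :=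
  [&& size s == k.+1, simplex s & sorted vlt s].

Definition forms_simplex s : Prop := exists2 t, perm_eq s t & simplex t.

(* Z(G): the variables of {mpoly int[n]} are indexed by 'I_n, hence enum_rank. *)
Definition ZG : comNzRingType := {mpoly int[#|vertex|]}.

Definition Cvar v : ZG := 'X_(enum_rank v).

Definition Csimplex s : ZG := \prod_(v <- s) Cvar v.

(* In R1 the family of vertices is nonempty. *)
Inductive rat_gen : ZG -> Prop :=
| R1 s : s != [::] -> ~ forms_simplex s -> rat_gen (Csimplex s)
| R2 u : rat_gen (Cvar u * \sum_v Cvar v)
| R3 u w i : u i != w i ->
    rat_gen (Cvar u * Cvar w * \sum_(v : vertex | v i == u i) Cvar v).

Definition rat_ideal : {pred ZG} := ideal_span rat_gen.

Lemma rat_idealr_closed : idealr_closed rat_ideal.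
Proof.
have [I0 IB] := ideal_span_zmod rat_gen.
split=> //; last first.
  move=> a p q pI qI; rewrite -[q]opprK; apply: (IB).
    exact: ideal_span_mul.
  by rewrite -sub0r; apply: (IB).
apply/negP => /ideal_spanP[s [sS]] /(congr1 (meval (fun=> 0 : int))).
rewrite rmorph1 rmorph_sum big_seq big1 => [/eqP|[a g] /sS /= gS].
  by rewrite oner_eq0.
have C0 v : meval (fun=> 0 : int) (Cvar v) = 0 by rewrite mevalXU.
rewrite rmorphM; case: gS => [[|v t]//= _ _|u|u w i _].
- by rewrite /Csimplex big_cons rmorphM /= C0 mul0r mulr0.
- by rewrite rmorphM /= C0 mul0r mulr0.
- by rewrite !rmorphM /= C0 !mul0r mulr0.
Qed.

HB.instance Definition _ := isIdealr.Build ZG rat_ideal rat_idealr_closed.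

Local Notation Chow := {ideal_quot rat_ideal}.

Definition chow_homog (m : nat) : {pred Chow} :=
  fun x => `[< exists2 p : {mpoly int[#|vertex|]}, p \is m.-homog & x = \pi_Chow (p : ZG) >].

Lemma chow_homog_zmod m : zmod_closed (chow_homog m).
Proof.
split; first by apply/asboolP; exists 0; [exact: rpred0|rewrite raddf0].
move=> _ _ /asboolP[p hp ->] /asboolP[q hq ->]; apply/asboolP.
by exists (p - q); [exact: rpredB|rewrite raddfB].
Qed.

HB.instance Definition _ m :=
  GRing.isZmodClosed.Build Chow (chow_homog m) (chow_homog_zmod m).

Record chow_part (m : nat) :=
  ChowPart { chow_val :> Chow; _ : chow_val \in chow_homog m }.
HB.instance Definition _ m := [isSub for @chow_val m].
HB.instance Definition _ m := [Choice of chow_part m by <:].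
HB.instance Definition _ m := [SubChoice_isSubZmodule of chow_part m by <:].

Inductive nd_monomial (k : nat) : ZG -> Prop :=
| NdMonomial s : nd_simplex k s -> nd_monomial k (Csimplex s).

Record Znd (k : nat) := MkZnd { znd_val :> ZG; _ : znd_val \in zspan (nd_monomial k) }.
HB.instance Definition _ k := [isSub for @znd_val k].
HB.instance Definition _ k := [Choice of Znd k by <:].
HB.instance Definition _ k := [SubChoice_isSubZmodule of Znd k by <:].

Definition cube u v : {set vertex} :=
  [set w : vertex | [forall i, (w i == u i) || (w i == v i)]].

(* R_{sigma,i,j} depends on sigma only through the consecutive vertices u < v
   of sigma with i, j in I(u, v). *)
Definition Rtilde u v (i j : 'I_d) : ZG :=
  \sum_(w in cube u v | w i == u i) Cvar w - \sum_(w in cube u v | w j == u j) Cvar w.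

(* sigma ranges over the nondegenerate (k-1)-simplices: no generator for k = 0. *)
Inductive nd_rel (k : nat) : ZG -> Prop :=
| NdRel k' s s1 s2 u v i j :
    k = k'.+1 -> nd_simplex k' s -> s = s1 ++ [:: u, v & s2] ->
    i \in dirs u v -> j \in dirs u v ->
    nd_rel k (Csimplex s * Rtilde u v i j).

Lemma cube_refine u v w i :
    simplex1 u v -> w \in cube u v -> w != u -> i \in dirs u v -> w i == u i ->
  [/\ simplex1 u w, simplex1 w v, vlt u w, vlt w v &
    [/\ dirs u w \subset dirs u v, dirs w v \subset dirs u v &
      [disjoint dirs u w & dirs w v]]].
Proof.
move=> /andP[/forallP uv /forallP Euv]; rewrite !inE => /forallP cw wu iuv wi.
have uw : vle u w by apply/forallP => j; case/orP: (cw j) => /eqP->.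
have wv : vle w v by apply/forallP => j; case/orP: (cw j) => /eqP->.
split; rewrite /simplex1 /vlt ?uw ?wv ?andbT //=.
- apply/forallP => j; case/orP: (cw j) => /eqP->; first by rewrite eqxx.
  exact: Euv.
- apply/forallP => j; case/orP: (cw j) => /eqP->; last by rewrite eqxx.
  exact: Euv.
- by rewrite eq_sym.
- by apply/negP => /eqP wv'; move: iuv; rewrite -(eqP wi) wv' ltxx.
split.
- by apply/subsetP => j; rewrite !inE; case/orP: (cw j) => /eqP-> //; rewrite ltxx.
- by apply/subsetP => j; rewrite !inE; case/orP: (cw j) => /eqP-> //; rewrite ltxx.
apply/pred0P => j /=; rewrite !inE; case/orP: (cw j) => /eqP->; rewrite ltxx //.
by rewrite andbF.
Qed.

Lemma nd_simplex_refine k s1 s2 u v w i :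
    nd_simplex k (s1 ++ [:: u, v & s2]) ->
    w \in cube u v -> w != u -> i \in dirs u v -> w i == u i ->
  nd_simplex k.+1 (s1 ++ [:: u, w, v & s2]).
Proof.
case/and3P=> sz sx srt cw wu iuv wi; apply/and3P.
have uv1 : simplex1 u v.
  case: s1 sx {sz srt} => [|x s1] /= /andP[]; first by move=> /andP[].
  by rewrite cat_path /= => /and4P[].
have [uw1 wv1 uw wv [Duw Dwv Dd]] := cube_refine uv1 cw wu iuv wi.
split.
- by move: sz; rewrite !size_cat /= !addnS.
- case: s1 sx {sz srt} => [|x s1] /= /andP[].
    move=> /andP[_ ->] /(@pairwise_disjoint_split _ [::] _ _ _ _ Duw Dwv Dd) /= ->.
    by rewrite uw1 wv1.
  rewrite !cat_path /= => /and4P[-> -> _ ->]; rewrite uw1 wv1 /=.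
  rewrite !pairmap_cat /= -!(cat_rcons (dirs (last x s1) u)).
  exact: pairwise_disjoint_split.
- case: s1 srt {sz sx} => [|x s1] /=; first by rewrite uw wv => /andP[].
  by rewrite !cat_path /= uw wv => /and4P[-> -> _ ->].
Qed.

(* The inclusion I_k^nd <= Z<G_k^nd>. *)
Lemma nd_rel_Znd k x : nd_rel k x -> x \in zspan (nd_monomial k).
Proof.
case=> k' s s1 s2 u v i j -> sx sE iuv juv; rewrite sE in sx *; rewrite /Rtilde.
have cu l : (u \in cube u v) && (u l == u l).
  by rewrite eqxx andbT inE; apply/forallP => m; rewrite eqxx.
rewrite (bigD1 u) ?cu // [X in _ - X](bigD1 u) ?cu //= opprD addrACA subrr add0r mulrBr.
have inZ l : l \in dirs u v -> Csimplex (s1 ++ [:: u, v & s2]) *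
    (\sum_(w | (w \in cube u v) && (w l == u l) && (w != u)) Cvar w)
    \in zspan (nd_monomial k'.+1).
  move=> luv; rewrite mulr_sumr; apply: rpred_sum => w /andP[/andP[cw wl] wu].
  have /NdMonomial/zspan_gen := nd_simplex_refine sx cw wu luv wl.
  rewrite /Csimplex !big_cat !big_cons /= => H.
  by rewrite -mulrA -[_ * Cvar w]mulrA [_ * Cvar w]mulrC [Cvar w * _]mulrCA in H *.
by apply: rpredB; apply: inZ.
Qed.

Definition I_nd (k : nat) : {pred Znd k} :=
  zspan (fun x : Znd k => nd_rel k (val x)).
Arguments I_nd : clear implicits.
HB.instance Definition _ k :=
  GRing.isZmodClosed.Build (Znd k) (I_nd k) (zspan_zmod _).

End ProductGraph.

Arguments I_nd {d disp V} E k.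

Notation Chow E := {ideal_quot (rat_ideal E)}.

(* Z<G_k^nd> / I_k^nd; Quotient.quot is the quotient of a zmodType by a subgroup. *)
Notation nd_quot E k := (Quotient.quot (I_nd E k)).

(* Main.v *)
(* For a simplex A, let Lam A be the group of linear forms spanned by the forms
   of R2 and R3 that become relations after multiplication by C_A.  Lam A grows
   with A, and its restriction to the vertices of A is onto Z^A.  If u in A and
   if a form L of Lam A restricts to the indicator of u on A, then
   C_u C_m = - sum_(w notin A) L(w) C_w C_m for every monomial C_m of support A;
   each step enlarges the support, so every monomial reduces to nondegenerate
   simplices.  The forms of Lam A that vanish on A are, modulo R1, the
   combinations of the R~_{A,i,j}, whence the relations I_k^nd.  Conversely,
   this reduction defines a map psi from monomials to Z<G_k^nd>/I_k^nd.  Its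
   independence of all choices, and psi(C_m L) = 0 for L in Lam(supp m), follow
   by induction on the defect deg m - #|supp m|, since two reductions at
   different vertices u, v of A lead to the same symmetric double sum
   sum_(w, x notin A) L_u(x) L_v(w) psi(C_w C_x C_m). *)

Require Import Defs.
From HB Require Import structures.
From mathcomp Require Import all_boot all_order all_algebra.
From mathcomp Require Import ring_quotient boolp mpoly.

Import Order.TTheory GRing.Theory.
Local Open Scope ring_scope.
Local Open Scope quotient_scope.

Set Implicit Arguments.
Unset Strict Implicit.
Unset Printing Implicit Defensive.

Lemma zspanS (M : zmodType) (S S' : M -> Prop) :
  (forall x, S x -> S' x) -> {subset zspan S <= zspan S'}.
Proof.
by move=> SS' _ /zspanP[s [sS ->]]; apply/zspanP; exists s; split=> // p /sS/SS'.
Qed.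

(** With the nondegenerate monomials as [S] and the Chow ideal as [I], it separates the result of a
    reduction from the terms that die in the quotient. *)
Lemma zspan_orP (M : zmodType) (S : M -> Prop) (I : zmodClosed M) (x : M) :
  x \in zspan (fun y => S y \/ y \in I) -> exists2 y, y \in zspan S & x - y \in I.
Proof.
case/zspanP=> s [sS ->]; elim: s sS => [|[c g] s IH] sS.
  by exists 0; rewrite ?rpred0 // big_nil subrr rpred0.
have [|y yS yI] := IH; first by move=> p ps; apply: sS; rewrite inE ps orbT.
rewrite big_cons /=; have [/= Sg|/= Ig] := sS (c, g) (mem_head _ _).
  exists (g *~ c + y); last by rewrite opprD addrACA subrr add0r.
  by rewrite rpredD // rpredMz //; apply: zspan_gen.
by exists y; rewrite // -addrA rpredD // rpredMz.
Qed.

(** * Supports and defects of monomials *)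

Section Monomials.

Variable T : finType.
Local Notation mon := 'X_{1..#|T|}.
Implicit Types (m : mon) (u v w : T).

Definition mvar v : mon := U_(enum_rank v)%MM.

Definition msupport m : {set T} := [set v | m (enum_rank v) != 0%N].

(** Counts repetitions; the truncated predecessor makes an absent vertex contribute 0. *)
Definition mdefect m : nat := (\sum_v (m (enum_rank v)).-1)%N.

Lemma mvarE v w : mvar v (enum_rank w) = (v == w).
Proof. by rewrite mnm1E (inj_eq enum_rank_inj). Qed.

Lemma msupportD m1 m2 : msupport (m1 + m2)%MM = msupport m1 :|: msupport m2.
Proof. by apply/setP => v; rewrite !inE mnmDE addn_eq0 negb_and. Qed.

Lemma msupport_mvar v : msupport (mvar v) = [set v].
Proof. by apply/setP => w; rewrite !inE mvarE eqb0 negbK eq_sym. Qed.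

Lemma msupport_addvar m v : msupport (m + mvar v)%MM = v |: msupport m.
Proof. by rewrite msupportD msupport_mvar setUC. Qed.

Lemma msupport_addvar_in m v :
  v \in msupport m -> msupport (m + mvar v)%MM = msupport m.
Proof. by move=> vm; rewrite msupport_addvar setUC; apply/setUidPl; rewrite sub1set. Qed.

Lemma mdefect_addvar m v :
  mdefect (m + mvar v)%MM = ((v \in msupport m) + mdefect m)%N.
Proof.
rewrite /mdefect (bigD1 v) //= [in RHS](bigD1 v) //= addnA; congr addn.
  by rewrite mnmDE mvarE eqxx addn1 inE; case: (m _).
by apply: eq_bigr => w wv; rewrite mnmDE mvarE eq_sym (negbTE wv) addn0.
Qed.

Lemma mdeg_addvar m v : mdeg (m + mvar v)%MM = (mdeg m).+1.
Proof. by rewrite mdegD mdeg1 addn1. Qed.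

Lemma mdeg_defect m : mdeg m = (#|msupport m| + mdefect m)%N.
Proof.
rewrite mdegE (reindex _ (onW_bij _ (@enum_rank_bij T))) /= -[#|msupport m|]sum1_card.
rewrite [X in (X + _)%N]big_mkcond -big_split; apply: eq_bigr => v _ /=.
by rewrite inE; case: (m _).
Qed.

Lemma mvar_split m u :
  (1 < m (enum_rank u))%N -> exists2 m', m = (m' + mvar u)%MM & u \in msupport m'.
Proof.
move=> mu; exists (m - mvar u)%MM; last by rewrite inE mnmBE mvarE eqxx -lt0n subn_gt0.
rewrite submK //; apply/mnm_lepP => i; rewrite mnm1E; case: eqP => //= <-.
exact: ltnW.
Qed.

Lemma mdefect_gt0 m : (0 < mdefect m)%N -> exists u, (1 < m (enum_rank u))%N.
Proof.
rewrite lt0n sum_nat_eq0 negb_forall => /existsP[u]; rewrite /= => mu; exists u.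
by move: mu; case: (m _) => [|[|]].
Qed.

End Monomials.

(** * Extending a map from squarefree monomials to all monomials *)

Section Extension.

Variables (T : finType) (Q : zmodType) (face : pred {set T}).
Variable gen : {set T} -> {ffun T -> int} -> Prop.
Variables (psi0 : {set T} -> Q) (k : nat).
Variable lift : {set T} -> T -> {ffun T -> int}.

Local Notation mon := 'X_{1..#|T|}.
Local Notation Lam A := (zspan (gen A)).
Implicit Types (A : {set T}) (m : mon) (u v w : T) (L K : {ffun T -> int}).

Hypothesis faceS : forall A B : {set T}, A \subset B -> face B -> face A.
Hypothesis genS : forall (A B : {set T}) L, A \subset B -> gen A L -> gen B L.
Hypothesis liftL : forall A u, face A -> u \in A -> lift A u \in Lam A.
Hypothesis liftE :
  forall A u v, face A -> u \in A -> v \in A -> lift A u v = (v == u)%:R.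
(** The only condition on [psi0], through which the relations of I_k^nd enter: the sum is the value
    on C_A times the form K, whose terms inside [A] vanish. *)
Hypothesis psi0_ker : forall A K, face A -> #|A| = k -> K \in Lam A ->
    (forall v, v \in A -> K v = 0) ->
  \sum_(v | (v \notin A) && face (v |: A)) psi0 (v |: A) *~ K v = 0.

Lemma LamS (A B : {set T}) : A \subset B -> {subset Lam A <= Lam B}.
Proof. by move=> AB; apply: zspanS => L; apply: genS. Qed.

(** R1 forces 0 on nonfaces. The fuel [j] is meant to be the defect: trading a repeated [u] for a
    [w] outside the support lowers the defect by one. The inner [else 0] is unreachable when [j] is
    the defect. *)
Fixpoint psi_rec (j : nat) (m : mon) : Q :=
  if ~~ face (msupport m) then 0 else
  if j is j'.+1 then
    if [pick u | (1 < m (enum_rank u))%N] is Some u then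
      - \sum_(w | w \notin msupport m)
          psi_rec j' (m - mvar u + mvar w)%MM *~ lift (msupport m) u w
    else 0
  else psi0 (msupport m).

Definition psi m : Q := psi_rec (mdefect m) m.

Definition psi_lin m L : Q := \sum_v psi (m + mvar v)%MM *~ L v.

(** The value of [psi] on C_m L K, with both forms truncated to the vertices outside the support of
    [m]. *)
Definition bil m L K : Q :=
  \sum_(w | w \notin msupport m) \sum_(x | x \notin msupport m)
    psi (m + mvar w + mvar x)%MM *~ L x *~ K w.

(** The degree is [k] because the linear form raises it to [k.+1]. *)
Definition ker_vanish j := forall m K, mdeg m = k -> mdefect m = j ->
  K \in Lam (msupport m) -> (forall v, v \in msupport m -> K v = 0) -> psi_lin m K = 0.

Definition lin_vanish j := forall m L, mdeg m = k -> mdefect m = j ->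
  L \in Lam (msupport m) -> psi_lin m L = 0.

Lemma psi_nonface m : ~~ face (msupport m) -> psi m = 0.
Proof. by rewrite /psi; case: (mdefect m) => [|j] /= ->. Qed.

Lemma psi_squarefree m :
  face (msupport m) -> mdefect m = 0%N -> psi m = psi0 (msupport m).
Proof. by rewrite /psi => fm -> /=; rewrite fm. Qed.

(** The new monomials have defect exactly one less, which is the remaining fuel of [psi_rec], so its
    recursive calls are again values of [psi]. *)
Lemma psi_step m : face (msupport m) -> (0 < mdefect m)%N ->
  exists m' u, [/\ m = (m' + mvar u)%MM, u \in msupport m' &
    psi m = - \sum_(w | w \notin msupport m')
      psi (m' + mvar w)%MM *~ lift (msupport m') u w].
Proof.
move=> fm m0; rewrite /psi.
case: {-1}(mdefect m) (erefl (mdefect m)) m0 => // j mj _ /=; rewrite fm /=.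
case: pickP => [u mu|nou].
  have [m' mE um'] := mvar_split mu; exists m', u; split=> //; congr (- _).
  move: mj; rewrite mE mdefect_addvar um' msupport_addvar_in // => -[jE].
  apply: eq_bigr => w wm'; rewrite addmK; congr (psi_rec _ _ *~ _).
  by rewrite mdefect_addvar (negbTE wm').
by have [|u] := @mdefect_gt0 _ m; rewrite ?mj // nou.
Qed.

Lemma psi_lin_is_zmod_morphism m : zmod_morphism (psi_lin m).
Proof. move=> L K; by rewrite -sumrB; apply: eq_bigr => v _; rewrite !ffunE mulrzBr. Qed.

HB.instance Definition _ m :=
  GRing.isZmodMorphism.Build {ffun T -> int} Q (psi_lin m) (psi_lin_is_zmod_morphism m).

Lemma psi_lin_nonface m L : ~~ face (msupport m) -> psi_lin m L = 0.
Proof.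
move=> fm; apply: big1 => v _; rewrite psi_nonface ?mul0rz //.
by apply: contra fm; apply: faceS; rewrite msupport_addvar subsetUr.
Qed.

Lemma psi_lin_split m L : psi_lin m L =
  \sum_(v in msupport m) psi (m + mvar v)%MM *~ L v +
  \sum_(v | v \notin msupport m) psi (m + mvar v)%MM *~ L v.
Proof. by rewrite /psi_lin (bigID (mem (msupport m))). Qed.

Lemma psi_lin_lift m u : face (msupport m) -> u \in msupport m ->
  psi_lin m (lift (msupport m) u) = psi (m + mvar u)%MM +
    \sum_(w | w \notin msupport m) psi (m + mvar w)%MM *~ lift (msupport m) u w.
Proof.
move=> fm um; rewrite psi_lin_split (bigD1 u) //= liftE // eqxx mulr1z.
rewrite big1 ?addr0 // => v /andP[vm vu].
by rewrite liftE // (negbTE vu) mulr0z.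
Qed.

Lemma bilC m L K : bil m L K = bil m K L.
Proof.
rewrite /bil exchange_big; apply: eq_bigr => w _; apply: eq_bigr => x _.
by rewrite -!mulrzA mulrC -addmA [(mvar _ + _)%MM]addmC addmA.
Qed.

(** For fixed [w] the inner sum is [psi_lin (m + mvar w) L], as L vanishes on the support of [m]. A
    new vertex [w] keeps the defect, so [lin_vanish j] applies. *)
Lemma bil_ker j m L K : lin_vanish j -> (mdeg m).+1 = k -> mdefect m = j ->
  L \in Lam (msupport m) -> (forall v, v \in msupport m -> L v = 0) ->
  bil m L K = 0.
Proof.
move=> rj dm jm LL L0; rewrite /bil big1 // => w wm.
rewrite -mulrz_suml (_ : \sum_(x | _) _ = psi_lin (m + mvar w)%MM L).
  rewrite rj ?mul0rz ?mdeg_addvar ?mdefect_addvar ?(negbTE wm) //.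
  by move: LL; apply: LamS; rewrite msupport_addvar subsetUr.
rewrite /psi_lin [in RHS](bigID (mem (msupport m))) /=.
rewrite [X in _ = X + _]big1 ?add0r // => v vm.
by rewrite L0 ?mulr0z.
Qed.

(** The same inner sum as in [bil_ker], except that the lift has one nonzero term on the support, at
    [u]; moving it across gives the sign. *)
Lemma bil_lift j m u K : lin_vanish j -> (mdeg m).+1 = k -> mdefect m = j ->
    face (msupport m) -> u \in msupport m ->
  bil m (lift (msupport m) u) K =
  - \sum_(w | w \notin msupport m) psi (m + mvar u + mvar w)%MM *~ K w.
Proof.
move=> rj dm jm fm um; rewrite /bil -sumrN; apply: eq_bigr => w wm.
rewrite -mulrz_suml -mulNrz; congr (_ *~ _); apply/eqP; rewrite -addr_eq0 addrC.
set L := lift _ _; have: psi_lin (m + mvar w)%MM L = 0.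
  rewrite rj ?mdeg_addvar ?mdefect_addvar ?(negbTE wm) //.
  by apply: LamS (liftL fm um); rewrite msupport_addvar subsetUr.
rewrite /psi_lin (bigID (mem (msupport m))) /= (bigD1 u) //= liftE // eqxx mulr1z.
rewrite big1 => [|v /andP[vm vu]]; last by rewrite liftE // (negbTE vu) mulr0z.
by rewrite addr0 -addmA [(mvar _ + mvar u)%MM]addmC addmA => ->.
Qed.

(* The value of psi does not depend on the repeated vertex chosen in psi_rec,
   because bil is symmetric. *)
Lemma psi_lin_lift0 j m u : (forall j', j = j'.+1 -> lin_vanish j') ->
    mdeg m = k -> mdefect m = j -> face (msupport m) -> u \in msupport m ->
  psi_lin m (lift (msupport m) u) = 0.
Proof.
move=> rj dm jm fm um; rewrite psi_lin_lift //.
have sE := msupport_addvar_in um.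
have [||m' [v [mE vm' ->]]] := @psi_step (m + mvar u)%MM.
- by rewrite sE.
- by rewrite mdefect_addvar um.
have [vu|vu] := eqVneq v u.
  have -> : m' = m by rewrite -[m'](addmK (mvar u)) -{1}vu -mE addmK.
  by rewrite vu addNr.
have um' : u \in msupport m'.
  have: u \in msupport (m + mvar u)%MM by rewrite sE.
  by rewrite mE msupport_addvar in_setU1 eq_sym (negbTE vu).
have sE' : msupport m' = msupport m by rewrite -sE mE msupport_addvar_in.
have vm : (1 < m (enum_rank v))%N.
  have /(congr1 (fun m : mon => m (enum_rank v))) := mE.
  rewrite /= !mnmDE !mvarE eqxx eq_sym (negbTE vu) addn0 addn1 => ->.
  by move: vm'; rewrite inE ltnS lt0n.
(* Since C_m = C_v C_m2, the reductions of C_u C_m at [u] and at [v] are both values of [bil m2],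
   with the two lifts exchanged. *)
have [m2 m2E vm2] := mvar_split vm.
have m'E : m' = (m2 + mvar u)%MM.
  by rewrite -[m'](addmK (mvar v)) -mE m2E -addmA [(mvar v + _)%MM]addmC addmA addmK.
have s2 : msupport m2 = msupport m by rewrite m2E msupport_addvar_in.
have jE : j = (mdefect m2).+1 by rewrite -jm m2E mdefect_addvar vm2.
have r2 : lin_vanish (mdefect m2) by apply: rj.
have d2 : (mdeg m2).+1 = k by rewrite -dm m2E mdeg_addvar.
have := bilC m2 (lift (msupport m2) u) (lift (msupport m2) v).
rewrite !(bil_lift _ r2) // ?s2 // => /oppr_inj.
by rewrite sE' m'E -m2E => ->; rewrite addNr.
Qed.

(** The lifts realize all indicators on the support, so a combination F of them agrees with L there;
    [psi_lin_lift0] handles F and [ker_vanish] handles L - F. *)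
Lemma lin_vanish_of_ker j : (forall j', j = j'.+1 -> lin_vanish j') -> ker_vanish j -> lin_vanish j.
Proof.
move=> rj kj m L dm jm LL; have [fm|] := boolP (face (msupport m)); last exact: psi_lin_nonface.
pose F := \sum_(u in msupport m) lift (msupport m) u *~ L u.
have FL : F \in Lam (msupport m) by apply: rpred_sum => u um; rewrite rpredMz ?liftL.
have linF : psi_lin m F = 0.
  rewrite raddf_sum; apply: big1 => u um.
  by rewrite raddfMz /= (psi_lin_lift0 rj) ?mul0rz.
have FE v : v \in msupport m -> F v = L v.
  move=> vm; rewrite sum_ffunE (bigD1 v) //= big1 => [|u /andP[um uv]].
    by rewrite ffunMzE liftE // eqxx addr0 intz.
  by rewrite ffunMzE liftE // eq_sym (negbTE uv) mul0rz.
rewrite -[L](subrK F) raddfD /= linF addr0 kj ?rpredB // => v vm.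
by rewrite !ffunE FE ?subrr.
Qed.

(** Pull a repeated [u] out of [m], leaving [m'] with the same support. Up to sign the sum is [bil]
    of K and the lift of [u] at [m'], and [bil_ker] applies because K vanishes on that support. *)
Lemma ker_vanish_succ j : lin_vanish j -> ker_vanish j.+1.
Proof.
move=> rj m K dm jm KL K0.
have [fm|] := boolP (face (msupport m)); last exact: psi_lin_nonface.
have [||m' [u [mE um' _]]] := @psi_step m; rewrite ?jm //.
have sE : msupport m = msupport m' by rewrite mE msupport_addvar_in.
rewrite psi_lin_split big1 ?add0r => [|v vm]; last by rewrite K0 ?mulr0z.
have jm' : mdefect m' = j by move: jm; rewrite mE mdefect_addvar um' => -[].
have dm' : (mdeg m').+1 = k by rewrite -dm mE mdeg_addvar.
rewrite sE in fm KL K0 *.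
have := bil_lift K rj dm' jm' fm um'; rewrite bilC (bil_ker _ rj) // -mE.
by move/eqP; rewrite eq_sym oppr_eq0 => /eqP.
Qed.

(** Defect 0 and degree [k] mean a squarefree monomial on [k] vertices, the case of [psi0_ker]. *)
Lemma ker_vanish0 : ker_vanish 0.
Proof.
move=> m K dm jm KL K0.
have [fm|] := boolP (face (msupport m)); last exact: psi_lin_nonface.
rewrite psi_lin_split big1 ?add0r => [|v vm]; last by rewrite K0 ?mulr0z.
have km : #|msupport m| = k by rewrite -dm mdeg_defect jm addn0.
rewrite -[RHS](psi0_ker fm km KL K0) (bigID (fun v => face (v |: msupport m))) /=.
rewrite [X in _ + X]big1 ?addr0 => [|v /andP[vm fv]].
  apply: eq_bigr => v /andP[vm fv]; rewrite psi_squarefree ?msupport_addvar //.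
  by rewrite mdefect_addvar (negbTE vm).
by rewrite psi_nonface ?mul0rz ?msupport_addvar.
Qed.

Lemma psi_lin_eq0 m L : mdeg m = k -> L \in Lam (msupport m) -> psi_lin m L = 0.
Proof.
suff: forall j, ker_vanish j /\ lin_vanish j by move=> H dm; apply: (H (mdefect m)).2.
elim=> [|j [kj rj]].
  by split; [exact: ker_vanish0|apply: lin_vanish_of_ker => //; exact: ker_vanish0].
split; first exact: ker_vanish_succ.
by apply: lin_vanish_of_ker (ker_vanish_succ rj) => _ [<-].
Qed.

(** The bound [< k.+2] makes the index type finite without losing a monomial of degree [k.+1]; other
    degrees go to 0. *)
Definition psi_ext (p : {mpoly int[#|T|]}) : Q :=
  \sum_(m : 'X_{1..#|T| < k.+2} | mdeg m == k.+1) psi m *~ p@_m.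

Lemma psi_ext_is_zmod_morphism : zmod_morphism psi_ext.
Proof.
by move=> p q; rewrite -sumrB; apply: eq_bigr => m _; rewrite mcoeffB mulrzBr.
Qed.

HB.instance Definition _ :=
  GRing.isZmodMorphism.Build {mpoly int[#|T|]} Q psi_ext psi_ext_is_zmod_morphism.

Lemma psi_extX m : psi_ext 'X_[m] = if mdeg m == k.+1 then psi m else 0.
Proof.
rewrite /psi_ext; case: eqP => [dm|dm]; last first.
  apply: big1 => m' /eqP dm'; rewrite mcoeffX; case: eqP => [mm|]; last by rewrite mulr0z.
  by case: dm; rewrite mm.
have bm : (mdeg m < k.+2)%N by rewrite dm.
rewrite (bigD1 (BMultinom bm)) /= ?dm // mcoeffX eqxx mulr1z big1 ?addr0 //.
move=> m' /andP[_ mm]; rewrite mcoeffX; case: eqP => [mE|]; last by rewrite mulr0z.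
by case/eqP: mm; apply: val_inj.
Qed.

Lemma psi_ext_lin m L : L \in Lam (msupport m) ->
  psi_ext ('X_[m] * \sum_v 'X_(enum_rank v) *~ L v) = 0.
Proof.
move=> LL; rewrite mulr_sumr raddf_sum.
have E v : psi_ext ('X_[m] * ('X_(enum_rank v) *~ L v)) =
    (if mdeg m == k then psi (m + mvar v)%MM else 0) *~ L v.
  by rewrite -mulrzr mulrA mulrzr -mpolyXD raddfMz /= psi_extX mdeg_addvar eqSS.
rewrite (eq_bigr _ (fun v _ => E v)).
case: eqP => [dm|_]; first exact: psi_lin_eq0.
by apply: big1 => v _; rewrite mul0rz.
Qed.

End Extension.

(** * Simplices of a product of graphs *)

Lemma split_at (T : Type) (P : pred T) (x : T) (s : seq T) :
  P x -> ~~ P (last x s) ->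
  exists s1 u v s2, [/\ x :: s = s1 ++ [:: u, v & s2], P u & ~~ P v].
Proof.
elim: s x => [|y s IH] x /= Px; first by rewrite Px.
have [Py|Py _] := boolP (P y); last by exists [::], x, y, s.
by move=> /(IH _ Py)[s1 [u [v [s2 [-> Pu Pv]]]]]; exists (x :: s1), u, v, s2.
Qed.

Section ProductComplex.

Variables (d : nat) (disp : Order.disp_t).
Variables (V : 'I_d -> finOrderType disp) (E : forall i, rel (V i)).

Implicit Types (u v w x y : vertex V) (s : seq (vertex V)) (A B : {set vertex V}).

Lemma vleP u v : reflect (forall i, (u i <= v i)%O) (vle u v).
Proof. exact: forallP. Qed.

Lemma vle_refl : reflexive (@vle d disp V).
Proof. by move=> u; apply/vleP. Qed.

Lemma vle_trans : transitive (@vle d disp V).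
Proof. by move=> v u w /vleP uv /vleP vw; apply/vleP => i; apply: le_trans (vw i). Qed.

Lemma vle_anti u v : vle u v -> vle v u -> u = v.
Proof.
by move=> /vleP uv /vleP vu; apply/ffunP => i; apply/eqP; rewrite eq_le uv vu.
Qed.

Lemma vlt_trans : transitive (@vlt d disp V).
Proof.
move=> v u w /andP[uv luv] /andP[vw lvw]; rewrite /vlt (vle_trans luv lvw) andbT.
by apply: contra uv => /eqP uw; rewrite (vle_anti luv) ?uw.
Qed.

Lemma dirs_neq0 u v : vlt u v -> exists i, i \in dirs u v.
Proof.
case/andP=> uv /vleP luv; apply/existsP; apply: contraR uv; rewrite negb_exists.
move=> /forallP H; apply/eqP/ffunP => i; apply: le_anti; rewrite luv /=.
by have := H i; rewrite inE -leNgt.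
Qed.

(* Disjointness of the sets I(v_j, v_{j+1}) amounts to no coordinate taking three
   values.  This order-free description also makes set0 a face. *)
Definition face A : bool :=
  [forall u in A, forall v in A, simplex1 E u v || simplex1 E v u] &&
  [forall u in A, forall v in A, forall w in A, forall i,
     ~~ ((u i < v i)%O && (v i < w i)%O)].

Lemma faceP A : reflect
  ((forall u v, u \in A -> v \in A -> simplex1 E u v || simplex1 E v u) /\
   (forall u v w i, u \in A -> v \in A -> w \in A ->
      (u i < v i)%O -> (v i < w i)%O -> False)) (face A).
Proof.
apply: (iffP andP) => -[H1 H2]; split.
- by move=> u v uA vA; move/forall_inP/(_ u uA)/forall_inP/(_ v vA): H1.
- move=> u v w i uA vA wA uv vw; move/forall_inP/(_ u uA)/forall_inP/(_ v vA): H2.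
  by move=> /forall_inP/(_ w wA)/forallP/(_ i); rewrite uv vw.
- by apply/forall_inP => u uA; apply/forall_inP => v vA; apply: H1.
- apply/forall_inP => u uA; apply/forall_inP => v vA; apply/forall_inP => w wA.
  by apply/forallP => i; apply/negP => /andP[]; apply: (H2 u v w).
Qed.

Lemma faceS A B : A \subset B -> face B -> face A.
Proof.
move=> /subsetP AB /faceP[H1 H2]; apply/faceP; split.
  by move=> u v /AB uB /AB vB; apply: H1.
by move=> u v w i /AB uB /AB vB /AB wB; apply: H2 uB vB wB.
Qed.

Lemma face_three A u v w i : face A -> u \in A -> v \in A -> w \in A ->
  (u i < v i)%O -> (v i < w i)%O -> False.
Proof. by case/faceP => _; apply. Qed.

Lemma face_total A u v : face A -> u \in A -> v \in A -> vle u v || vle v u.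
Proof.
by case/faceP => H _ uA vA; case/orP: (H u v uA vA) => /andP[-> _]; rewrite ?orbT.
Qed.

Lemma face_simplex1 A u v :
  face A -> u \in A -> v \in A -> vle u v -> simplex1 E u v.
Proof.
case/faceP => H _ uA vA uv; case/orP: (H u v uA vA) => // /andP[vu _].
rewrite (vle_anti uv vu) /simplex1 vle_refl /=.
by apply/forallP => i; rewrite eqxx.
Qed.

Lemma path_vle_min v s : path (@vle _ _ _) v s -> {in v :: s, forall w, vle v w}.
Proof.
move=> /(order_path_min vle_trans)/allP vs w; rewrite in_cons => /predU1P[->|/vs//].
exact: vle_refl.
Qed.

Lemma dirs_pairmap v s a b i : path (@vle _ _ _) v s ->
    a \in v :: s -> b \in v :: s -> (a i < b i)%O ->
  exists2 D, D \in pairmap (@dirs _ _ _) v s & i \in D.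
Proof.
elim: s v a b => [|x s IH] v a b /=; first by rewrite !inE => _ /eqP-> /eqP->; rewrite ltxx.
case/andP=> vx xs; have vmin : {in [:: v, x & s], forall w, vle v w}.
  by apply: path_vle_min; rewrite /= vx.
rewrite [a \in _]in_cons [b \in _]in_cons.
have key a' b' : a' \in x :: s -> b' \in x :: s -> (a' i < b' i)%O ->
    exists2 D, D \in dirs v x :: pairmap (@dirs _ _ _) x s & i \in D.
  by move=> aI bI /(IH x _ _ xs aI bI)[D DI iD]; exists D; rewrite // inE DI orbT.
case/predU1P=> [->|aI]; case/predU1P=> [->|bI]; last exact: key.
- by rewrite ltxx.
- move=> vb; have [vxi|] := boolP (v i < x i)%O.
    by exists (dirs v x); rewrite !inE ?eqxx ?vxi.
  (* The first step does not raise coordinate [i], so [x] can replace [v] as the lower vertex. *)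
  rewrite -leNgt => xv; apply: (key x b); rewrite ?inE ?eqxx //.
  exact: le_lt_trans vb.
- by move=> av; have /vleP/(_ i) := vmin a (@mem_behead _ [:: v, x & s] _ aI); rewrite leNgt av.
Qed.

Lemma simplex_cons u v s : simplex E [:: u, v & s] =
  [&& simplex1 E u v,
      all (fun D : {set 'I_d} => [disjoint dirs u v & D]) (pairmap (@dirs _ _ _) v s)
    & simplex E (v :: s)].
Proof. by rewrite /= -!andbA; do !bool_congr. Qed.

Lemma simplex_path v s : simplex E (v :: s) -> path (@vle _ _ _) v s.
Proof. by case/andP=> H _; apply: sub_path H => x y /andP[]. Qed.

(** Disjoint direction sets let each coordinate move at most once, so any two vertices, not just
    consecutive ones, agree or are adjacent in every coordinate, and no coordinate takes three
    values. *)
Lemma simplex_face s : simplex E s -> face [set x in s].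
Proof.
case: s => // v s; elim: s v => [|x s IH] v.
  move=> _; apply/faceP; split => [a b|a b c i]; rewrite !inE => /eqP-> /eqP->.
    by rewrite /simplex1 vle_refl orbb; apply/forallP => i; rewrite eqxx.
  by rewrite ltxx.
move=> sx; have vmin := path_vle_min (simplex_path sx).
move: sx; rewrite simplex_cons => /and3P[vx /allP disj xs].
have /faceP[F1 F2] := IH x xs.
have s1 w : w \in x :: s -> simplex1 E v w.
  move=> ws; have /andP[_ /forallP Evx] := vx.
  have [xI wI] : x \in [set y in x :: s] /\ w \in [set y in x :: s].
    by rewrite !in_set mem_head ws.
  have /orP[] := F1 x w xI wI => /andP[/vleP xw /forallP Exw]; last first.
    have -> : w = x.
      by apply: vle_anti (path_vle_min (simplex_path xs) ws); apply/vleP.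
    by [].
  apply/andP; split; first by apply: vmin; rewrite inE ws orbT.
  apply/forallP => i; have /vleP/(_ i) vxi : vle v x by case/andP: vx.
  have /orP[/eqP->//|Ei] := Evx i.
  have [/eqP<-|xwi] := boolP (x i == w i); first by rewrite Ei orbT.
  have {}xwi : (x i < w i)%O by rewrite lt_neqAle xwi xw.
  have [D DI iD] := dirs_pairmap (simplex_path xs) (mem_head _ _) ws xwi.
  have {DI} := disj D DI; move: vxi; rewrite le_eqVlt => /predU1P[->|vxi].
    by move: (Exw i).
  by move=> dis; have := @disjointFr _ _ _ i dis; rewrite inE vxi iD => /(_ isT).
apply/faceP; split => [a b|a b c i].
  rewrite !in_set ![_ \in v :: _]in_cons => /predU1P[->|aI] /predU1P[->|bI].
  - by rewrite /simplex1 vle_refl orbb; apply/forallP => i; rewrite eqxx.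
  - by rewrite s1.
  - by rewrite s1 ?orbT.
  - by apply: F1; rewrite in_set.
rewrite !in_set => aI bI cI ab bc.
have nv (y z : vertex V) :
    y \in [:: v, x & s] -> (y i < z i)%O -> z \in [:: v, x & s] -> z \in x :: s.
  move=> yI yz; rewrite in_cons => /predU1P[zv|//].
  by have /vleP/(_ i) := vmin y yI; rewrite leNgt -zv yz.
have bI' := nv a b aI ab bI; have cI' := nv b c bI bc cI.
move: aI; rewrite in_cons => /predU1P[aE|aI]; last first.
  by apply: (F2 a b c i); rewrite ?in_set.
have [vxi|] := boolP (v i < x i)%O.
  have [D DI iD] := dirs_pairmap (simplex_path xs) bI' cI' bc.
  by have := @disjointFr _ _ _ i (disj D DI); rewrite inE vxi iD => /(_ isT).
rewrite -leNgt => xv; apply: (F2 x b c i); rewrite ?in_set ?mem_head //.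
by apply: le_lt_trans xv _; rewrite -aE.
Qed.

(** A direction shared by two steps would give three values of one coordinate. Weak sorting admits
    repeated vertices, which contribute empty direction sets. *)
Lemma face_simplex A s : face A -> s != [::] -> {subset s <= A} ->
  sorted (@vle _ _ _) s -> simplex E s.
Proof.
move=> fA; case: s => // v s _; elim: s v => [|x s IH] v // sA so; have /andP[vx xs] := so.
have vA : v \in A by apply: sA; rewrite mem_head.
have xA : x \in A by apply: sA; rewrite !inE eqxx orbT.
rewrite simplex_cons (face_simplex1 fA) // andTb.
apply/andP; split; last first.
  by apply: IH => // y ys; apply: sA; rewrite inE ys orbT.
apply/allP => D /(nthP set0)[j]; rewrite size_pairmap => js <-.
rewrite (nth_pairmap x) //; apply/pred0P => i /=; rewrite !inE.
apply/negP => /andP[vxi nni].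
have nA l : (l <= size s)%N -> nth x (x :: s) l \in A.
  by move=> ls; apply: sA; rewrite in_cons mem_nth ?orbT.
apply: (@face_three A v x (nth x s j) i) => //; first exact: (nA j.+1).
apply: le_lt_trans nni; apply/vleP.
by apply: (path_vle_min xs); rewrite mem_nth //= ltnW.
Qed.

(** Vertices of a face are pairwise comparable, so sorting them yields a simplex. The empty list is
    excluded because [set0] is a face while [[::]] is not a simplex. *)
Lemma forms_simplexP s : s != [::] -> forms_simplex E s <-> face [set x in s].
Proof.
move=> s0; split=> [[t st /simplex_face]|fs].
  by congr face; apply/setP => x; rewrite !inE (perm_mem st).
exists (sort (@vle _ _ _) s); first by rewrite perm_sym perm_sort.
apply: (face_simplex fs).
- by rewrite -size_eq0 size_sort size_eq0.
- by move=> x; rewrite mem_sort inE.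
- apply: (sort_sorted_in (P := mem s)); last exact/allP.
  by move=> x y xs ys; apply: (face_total fs); rewrite inE.
Qed.

Lemma vlt_sorted s : sorted (@vlt _ _ _) s = uniq s && sorted (@vle _ _ _) s.
Proof.
rewrite (sorted_pairwise vlt_trans) (sorted_pairwise vle_trans) uniq_pairwise.
by rewrite -pairwise_relI.
Qed.

Lemma nd_simplexP k s : reflect
  [/\ size s = k.+1, face [set x in s] & sorted (@vlt _ _ _) s] (nd_simplex E k s).
Proof.
apply: (iffP and3P) => -[ss fs so]; split=> //; rewrite ?ss ?(eqP ss) //.
  exact: simplex_face.
apply: (face_simplex fs); first by rewrite -size_eq0 ss.
  by move=> x; rewrite inE.
by move: so; rewrite vlt_sorted => /andP[].
Qed.

Lemma face_chain A : face A ->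
  exists s, [/\ A = [set x in s], sorted (@vlt _ _ _) s & size s = #|A|].
Proof.
move=> fA; exists (sort (@vle _ _ _) (enum A)); split.
- by apply/setP => x; rewrite inE mem_sort mem_enum.
- rewrite vlt_sorted sort_uniq enum_uniq.
  apply: (sort_sorted_in (P := mem A)); last by apply/allP => x; rewrite mem_enum.
  by move=> x y xs ys; apply: (face_total fA).
- by rewrite size_sort cardE.
Qed.

(** * Consecutive vertices and the star of a face *)

Definition consecutive A u v : Prop :=
  [/\ u \in A, v \in A, vlt u v & forall w, w \in A -> vle w u || vle v w].

Lemma chain_consecutive s1 s2 u v : sorted (@vlt _ _ _) (s1 ++ [:: u, v & s2]) ->
  consecutive [set x in s1 ++ [:: u, v & s2]] u v.
Proof.
move=> so; split; rewrite ?in_set ?mem_cat ?inE ?eqxx ?orbT //.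
  by have [_ /andP[]] := cat_sorted2 so.
move: so; rewrite (sorted_pairwise vlt_trans) pairwise_cat.
case/and3P=> /allrelP s1u _ /= /and3P[_ /allP vs _] w.
rewrite in_set mem_cat !in_cons => /or4P[ws|/eqP->|/eqP->|ws].
- by have /andP[_ ->] := s1u w u ws (mem_head _ _).
- by rewrite vle_refl.
- by rewrite vle_refl orbT.
- by have /andP[_ ->] := vs w ws; rewrite orbT.
Qed.

(** If coordinate [i] varies on [A] and [w] lies in the star of [A], this coordinate takes only two
    values on [w |: A]; [low A i w] then says that [w] has the smaller one. *)
Definition low A i w : bool := [exists u in A, (w i < u i)%O].

Definition fdirs A : {set 'I_d} :=
  [set i | [exists u in A, exists v in A, (u i < v i)%O]].

Lemma dirs_fdirs A u v i : u \in A -> v \in A -> i \in dirs u v -> i \in fdirs A.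
Proof.
by move=> uA vA; rewrite !inE => uv; apply/exists_inP; exists u => //;
  apply/exists_inP; exists v.
Qed.

Lemma low_dirs A u v w i : face (w |: A) -> u \in A -> v \in A ->
  i \in dirs u v -> low A i w = (w i == u i).
Proof.
move=> fA uA vA; rewrite inE => uv.
have [wA uA' vA'] : [/\ w \in w |: A, u \in w |: A & v \in w |: A].
  by rewrite !in_setU1 uA vA eqxx !orbT.
apply/exists_inP/eqP => [[x xA wx]|->]; last by exists v.
apply/eqP; apply: contraT; case: (ltgtP (w i) (u i)) => // [wu|uw] _.
  by case: (face_three fA wA uA' vA' wu uv).
by case: (face_three fA uA' wA (setU1r w xA) uw wx).
Qed.

(** A vertex of the star is comparable to [u] and [v]; between them, the two-value condition would
    put it in the cube. Hence it is below [u] or above [v], where all directions of I(u, v) behave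
    alike. So, modulo R1, only the cube contributes to the difference of two R3 forms. *)
Lemma star_cube A u v w i j : face (w |: A) -> consecutive A u v ->
    i \in dirs u v -> j \in dirs u v -> w \notin cube u v ->
  (w i == u i) = (w j == u j).
Proof.
move=> fA [uA vA /andP[_ /vleP uv] _] iuv juv ncube.
have [wA uA' vA'] : [/\ w \in w |: A, u \in w |: A & v \in w |: A].
  by rewrite !in_setU1 uA vA eqxx !orbT.
have [/vleP wu|wu] := boolP (vle w u).
  suff H l : l \in dirs u v -> w l == u l by rewrite !H.
  rewrite inE eq_le wu leNgt => uvl; apply/negP => wul.
  exact: (face_three fA wA uA' vA' wul uvl).
have [/vleP vw|vw] := boolP (vle v w).
  suff H l : l \in dirs u v -> w l != u l by rewrite !(negbTE (H _ _)).
  by rewrite inE => uvl; rewrite gt_eqF // (lt_le_trans uvl).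
case/negP: ncube; rewrite inE; apply/forallP => l.
have /vleP uw : vle u w by have := face_total fA wA uA'; rewrite (negbTE wu).
have /vleP wv : vle w v by have := face_total fA vA' wA; rewrite (negbTE vw).
rewrite eq_sym; apply: contraT; rewrite negb_or => /andP[uwl wvl].
case: (@face_three _ u w v l fA) => //; rewrite lt_neqAle ?uwl ?wvl ?uw ?wv //.
Qed.

(** A vertex of [A] exceeding [u] in coordinate [i] must be above [v], so direction [i] jumps in
    this gap exactly when [low] switches there. *)
Lemma consecutive_dirs A u v i : face A -> consecutive A u v ->
  (i \in dirs u v) = low A i u && ~~ low A i v.
Proof.
move=> fA [uA vA /andP[_ /vleP uv] tot]; apply/idP/andP => [|[/exists_inP[x xA ux] lv]].
  rewrite inE => uvi; split; first by apply/exists_inP; exists v.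
  by apply/exists_inP => -[x xA]; exact: (face_three fA uA vA xA uvi).
have /orP[/vleP xu|/vleP vx] := tot x xA; first by have := xu i; rewrite leNgt ux.
rewrite inE lt_neqAle uv andbT; apply: contra lv => /eqP uvE.
by apply/exists_inP; exists x; rewrite -?uvE.
Qed.

Lemma low_vle A u v i : vle u v -> low A i v -> low A i u.
Proof.
move=> /vleP uv /exists_inP[x xA vx]; apply/exists_inP; exists x => //.
exact: le_lt_trans vx.
Qed.

Lemma chain_last x s : sorted (@vle _ _ _) (x :: s) ->
  {in x :: s, forall y, vle y (last x s)}.
Proof.
rewrite (sorted_pairwise vle_trans) lastI pairwise_rcons => /andP[/allP la _] y.
by rewrite mem_rcons inE => /predU1P[->|/la//]; exact: vle_refl.
Qed.

(** [low A i] holds at the first vertex of the chain and fails at the last; the gap sought is where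
    it switches. *)
Lemma chain_split A i : face A -> i \in fdirs A ->
  exists s1 u v s2, [/\ A = [set x in s1 ++ [:: u, v & s2]],
    sorted (@vlt _ _ _) (s1 ++ [:: u, v & s2]),
    size (s1 ++ [:: u, v & s2]) = #|A| & i \in dirs u v].
Proof.
move=> fA; rewrite inE => /exists_inP[x xA /exists_inP[y yA xy]].
have [s [AE so sz]] := face_chain fA.
case: s => [|a s] in AE so sz; first by move: xA; rewrite AE inE.
have le_a : {in A, forall z, vle a z}.
  move=> z; rewrite AE inE; apply: path_vle_min.
  by move: so; rewrite vlt_sorted => /andP[].
have le_last : {in A, forall z, vle z (last a s)}.
  move=> z; rewrite AE inE; apply: chain_last.
  by move: so; rewrite vlt_sorted => /andP[].
have [||s1 [u [v [s2 [sE lu lv]]]]] := @split_at _ (low A i) a s.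
- apply/exists_inP; exists y => //; apply: le_lt_trans xy.
  exact/vleP/le_a.
- apply/exists_inP => -[z zA]; rewrite ltNge => /negP; apply.
  exact/vleP/le_last.
exists s1, u, v, s2; rewrite -sE; split=> //; rewrite (consecutive_dirs _ fA) ?lu //.
by rewrite AE sE; apply: chain_consecutive; rewrite -sE.
Qed.

(** * Linear forms available on a face *)

(** Coefficient functions of the forms of R2 and R3 whose multipliers C_u or C_u C_v divide C_A; the
    empty face has none. *)
Inductive lin_gen A : {ffun vertex V -> int} -> Prop :=
| LinAll u : u \in A -> lin_gen A [ffun=> 1]
| LinCoord u v i : u \in A -> v \in A -> u i != v i ->
    lin_gen A [ffun w : vertex V => (w i == u i)%:R].

Lemma lin_genS A B L : A \subset B -> lin_gen A L -> lin_gen B L.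
Proof.
move=> /subsetP AB [u /AB uB|u v i /AB uB /AB vB]; first exact: LinAll uB.
exact: LinCoord.
Qed.

(* On the star of A, every R2 or R3 form is an integer combination of the
   constant form and of the indicators of "i-th coordinate minimal on A". *)
Lemma lin_normal A L : face A -> L \in zspan (lin_gen A) ->
  exists a (b : 'I_d -> int), forall w, face (w |: A) ->
    L w = a + \sum_(i in fdirs A) b i * (low A i w)%:R.
Proof.
move=> fA /zspanP[s [sS ->]]; elim: s sS => [|[c g] s IH] sS.
  exists 0, (fun=> 0) => w _; rewrite big_nil ffunE add0r big1 // => i _.
  by rewrite mul0r.
have [|a [b IHE]] := IH; first by move=> p ps; apply: sS; rewrite inE ps orbT.
suff [a' [b' gE]] : exists a (b : 'I_d -> int), forall w, face (w |: A) ->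
    g w = a + \sum_(i in fdirs A) b i * (low A i w)%:R.
  exists (c * a' + a), (fun i => c * b' i + b i) => w fw.
  rewrite big_cons ffunE ffunMzE IHE // gE // -mulrzr intz mulrC mulrDr addrACA.
  congr (_ + _); rewrite mulr_sumr -big_split; apply: eq_bigr => i _ /=.
  by rewrite mulrDl mulrA.
have /= := sS (c, g) (mem_head _ _) => -[u uA|u v i uA vA uv].
  exists 1, (fun=> 0) => w _; rewrite ffunE big1 ?addr0 // => i _.
  by rewrite mul0r.
(* On the star of [A], the indicator of w_i = u_i is [low A i] if u_i < v_i, and 1 minus [low A i]
   if v_i < u_i. *)
have [uvi|vui|uvE] := ltgtP (u i) (v i); last by rewrite uvE eqxx in uv.
  have iA : i \in fdirs A by apply: (dirs_fdirs uA vA); rewrite inE.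
  exists 0, (fun j => (j == i)%:R) => w fw; rewrite ffunE (bigD1 i) //= eqxx mul1r.
  rewrite (@low_dirs A u v) ?inE // big1 ?addr0 ?add0r // => j /andP[_ ji].
  by rewrite (negbTE ji) mul0r.
have iA : i \in fdirs A by apply: (dirs_fdirs vA uA); rewrite inE.
exists 1, (fun j => - (j == i)%:R) => w fw; rewrite ffunE (bigD1 i) //= eqxx.
rewrite big1 ?addr0 => [|j /andP[_ ji]]; last by rewrite (negbTE ji) oppr0 mul0r.
have [wA uA' vA'] : [/\ w \in w |: A, u \in w |: A & v \in w |: A].
  by rewrite !in_setU1 uA vA eqxx !orbT.
rewrite (@low_dirs A v u) ?inE // mulN1r.
have [wv|wv] := eqVneq (w i) (v i); first by rewrite wv lt_eqF // subrr.
have [wu|wu] := eqVneq (w i) (u i); first by rewrite subr0.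
case: (ltgtP (w i) (v i)) wv => // [wv|vw] _.
  by case: (face_three fw wA vA' uA' wv vui).
case: (ltgtP (w i) (u i)) wu => // [wu|uw] _.
  by case: (face_three fw vA' wA uA' vw wu).
by case: (face_three fw vA' uA' wA vui uw).
Qed.

(** In the normal form of L, the last vertex of the chain gives a = 0, and consecutive [u], [v] give
    that the b_i sum to 0 over I(u, v). So L is a combination of differences [low A i] - [low A j]
    with i, j in a common gap, and these are killed by the last hypothesis. *)
Lemma lin_gen_ker (Q : zmodType) (q : vertex V -> Q) A L :
    face A -> L \in zspan (lin_gen A) -> (forall v, v \in A -> L v = 0) ->
    (forall w, w \notin A -> ~~ face (w |: A) -> q w = 0) ->
    (forall s1 u v s2 i j, A = [set x in s1 ++ [:: u, v & s2]] ->
       sorted (@vlt _ _ _) (s1 ++ [:: u, v & s2]) ->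
       size (s1 ++ [:: u, v & s2]) = #|A| ->
       i \in dirs u v -> j \in dirs u v ->
       \sum_(w : vertex V | w \notin A) q w *~ (w i == u i)%:R =
       \sum_(w : vertex V | w \notin A) q w *~ (w j == u j)%:R) ->
  \sum_(w | w \notin A) q w *~ L w = 0.
Proof.
move=> fA LL L0 q0 qE.
have faceU w : w \in A -> face (w |: A).
  by move=> wA; rewrite (setUidPr _) ?sub1set.
have [s [AE so sz]] := face_chain fA; case: s => [|x s] in AE so sz.
  (* The empty face has no generators, so L itself is 0. *)
  have A0 u : u \notin A by rewrite AE inE.
  suff -> : L = 0 by apply: big1 => w _; rewrite ffunE mulr0z.
  case/zspanP: LL => -[|p t] [tS ->]; first by rewrite big_nil.
  by have [u|u v i] := tS p (mem_head _ _); rewrite (negbTE (A0 u)).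
have [a [b LE]] := lin_normal fA LL.
have a0 : a = 0.
  have lA : last x s \in A by rewrite AE inE mem_last.
  have := LE _ (faceU _ lA); rewrite L0 // big1 ?addr0 // => i _.
  suff /negbTE-> : ~~ low A i (last x s) by rewrite mulr0.
  apply/exists_inP => -[z]; rewrite AE inE => zs; rewrite ltNge => /negP; apply.
  move: i; apply/vleP; apply: chain_last => //.
  by move: so; rewrite vlt_sorted => /andP[].
have dir_sum0 u v : consecutive A u v -> \sum_(i in dirs u v) b i = 0.
  move=> uvA; have [uA vA /andP[_ uv] _] := uvA.
  have : L u - L v = 0 by rewrite !L0 ?subrr.
  rewrite !LE ?faceU // opprD addrACA subrr add0r -sumrB => LuvE.
  rewrite -[RHS]LuvE [LHS]big_mkcond [RHS]big_mkcond; apply: eq_bigr => i _ /=.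
  rewrite -mulrBr (consecutive_dirs _ fA uvA).
  have [iA|iA] := boolP (i \in fdirs A).
    by have := @low_vle A u v i uv; case: (low A i v) => [->//|_];
      rewrite ?subrr ?mulr0 //; case: (low A i u); rewrite ?subr0 ?mulr0 ?mulr1.
  by rewrite -(consecutive_dirs _ fA uvA) ifN //; apply: contra iA; exact: dirs_fdirs.

pose F i := \sum_(w : vertex V | w \notin A) q w *~ (low A i w)%:R.
have -> : \sum_(w | w \notin A) q w *~ L w = \sum_(i in fdirs A) F i *~ b i.
  under [RHS]eq_bigr do rewrite mulrz_suml.
  rewrite exchange_big /=; apply: eq_bigr => w wA.
  have [fw|fw] := boolP (face (w |: A)); last first.
    by rewrite q0 // mul0rz big1 // => i _; rewrite !mul0rz.
  rewrite LE // a0 add0r mulrz_sumr; apply: eq_bigr => i _.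
  by rewrite -mulrzA mulrC.
(* Directions are grouped by the initial segment of the chain on which they are low: two directions
   of [fdirs A] share it exactly when they jump in the same gap. *)
pose D i := [set x in A | low A i x].
rewrite (partition_big D predT) //=; apply: big1 => B _.
have [i0 /andP[i0A /eqP BE]|noi] := pickP (fun i => (i \in fdirs A) && (D i == B)); last first.
  by rewrite big_pred0.
have [s1 [u [v [s2 [AE' so' sz' i0uv]]]]] := chain_split fA i0A.
have uvA : consecutive A u v by rewrite AE'; apply: chain_consecutive.
have [uA vA _ _] := uvA.
rewrite (eq_bigl (mem (dirs u v))) => [|i].
  rewrite (eq_bigr (fun i => F i0 *~ b i)) => [|i iuv].
    by rewrite -mulrz_sumr dir_sum0.
  congr (_ *~ _); rewrite /F.
  have FE j : j \in dirs u v -> F j =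
      \sum_(w : vertex V | w \notin A) q w *~ (w j == u j)%:R.
    move=> juv; apply: eq_bigr => w wA.
    have [fw|fw] := boolP (face (w |: A)); last by rewrite q0 // !mul0rz.
    by rewrite (low_dirs fw uA vA juv).
  by rewrite -/(F i) -/(F i0) !FE // (qE s1 u v s2 i i0).
rewrite -BE; apply/andP/idP => [[iA /eqP DE]|iuv].
  have low_i z : z \in A -> low A i z = low A i0 z.
    by move=> zA; move/setP/(_ z): DE; rewrite !inE zA.
  move: i0uv; rewrite (consecutive_dirs _ fA uvA) -!low_i //.
  by rewrite -(consecutive_dirs _ fA uvA).
split; first exact: dirs_fdirs iuv.
have low_u j z : j \in dirs u v -> z \in A -> low A j z = vle z u.
  rewrite (consecutive_dirs _ fA uvA) => /andP[lu lv] zA.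
  apply/idP/idP => [lz|zu]; last exact: low_vle lu.
  have [_ _ _ /(_ z zA)/orP[//|vz]] := uvA.
  by case/negP: lv; apply: low_vle lz.
apply/eqP/setP => z; rewrite !inE; have [zA|//] := boolP (z \in A).
by rewrite /= !low_u.
Qed.

(** If [x] precedes [u] in the chain and [i] jumps from [x] to [u], then on [A] the condition w_i =
    u_i selects the vertices from [u] on. For the first vertex the constant form serves. *)
Lemma lin_lower A u : face A -> u \in A ->
  exists2 L, L \in zspan (lin_gen A) & forall w, w \in A -> L w = (vle u w)%:R.
Proof.
move=> fA uA; have [s [AE so sz]] := face_chain fA.
have us : u \in s by move: uA; rewrite AE inE.
case/splitPr: us => s1 s2 in AE so sz.
case/lastP: s1 => [|s1 x] in AE so sz.
  exists [ffun=> 1]; first by apply: zspan_gen; exact: LinAll uA.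
  move=> w; rewrite AE inE ffunE => wu; rewrite (@path_vle_min u s2) //.
  by move: so; rewrite vlt_sorted => /andP[].
rewrite cat_rcons in AE so sz.
have xuA : consecutive A x u by rewrite AE; apply: chain_consecutive.
have [xA _ xu tot] := xuA; have [i ixu] := dirs_neq0 xu.
have xui : (x i < u i)%O by rewrite inE in ixu.
exists [ffun w : vertex V => (w i == u i)%:R].
  by apply: zspan_gen; apply: (LinCoord uA xA); rewrite gt_eqF.
move=> w wA; rewrite ffunE; congr ((nat_of_bool _)%:R).
have [uw|nuw] := boolP (vle u w).
  rewrite eq_le (vleP _ _ uw) andbT leNgt; apply/negP => uwi.
  exact: (face_three fA xA uA wA xui uwi).
have /orP[/vleP wx|uw] := tot w wA; last by rewrite uw in nuw.
by rewrite lt_eqF // (le_lt_trans (wx i)).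
Qed.

(** Mirror image of [lin_lower]: a direction jumping from [u] to its successor selects the vertices
    up to [u]. *)
Lemma lin_upper A u : face A -> u \in A ->
  exists2 L, L \in zspan (lin_gen A) & forall w, w \in A -> L w = (vle w u)%:R.
Proof.
move=> fA uA; have [s [AE so sz]] := face_chain fA.
have us : u \in s by move: uA; rewrite AE inE.
case/splitPr: us => s1 s2 in AE so sz.
case: s2 => [|x s2] in AE so sz.
  exists [ffun=> 1]; first by apply: zspan_gen; exact: LinAll uA.
  move=> w; rewrite AE inE ffunE cats1 mem_rcons inE => wu.
  move: so; rewrite vlt_sorted (sorted_pairwise vle_trans) cats1 pairwise_rcons.
  case/and3P=> _ /allP wle _; case/predU1P: wu => [->|/wle->//].
  by rewrite vle_refl.
have uxA : consecutive A u x by rewrite AE; apply: chain_consecutive.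
have [_ xA ux tot] := uxA; have [i iux] := dirs_neq0 ux.
have uxi : (u i < x i)%O by rewrite inE in iux.
exists [ffun w : vertex V => (w i == u i)%:R].
  by apply: zspan_gen; apply: (LinCoord uA xA); rewrite lt_eqF.
move=> w wA; rewrite ffunE; congr ((nat_of_bool _)%:R).
have [wu|nwu] := boolP (vle w u).
  rewrite eq_le (vleP _ _ wu) /= leNgt; apply/negP => wui.
  exact: (face_three fA wA uA xA wui uxi).
have /orP[wu|/vleP xw] := tot w wA; first by rewrite wu in nwu.
by rewrite gt_eqF // (lt_le_trans uxi).
Qed.

(** On a chain the indicator of [u] is [u <= w] + [w <= u] - 1. *)
Lemma lin_delta A u : face A -> u \in A ->
  exists2 L, L \in zspan (lin_gen A) & forall w, w \in A -> L w = (w == u)%:R.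
Proof.
move=> fA uA; have [L LL LE] := lin_lower fA uA; have [K KK KE] := lin_upper fA uA.
exists (L + K - [ffun=> 1]).
  by rewrite rpredB ?rpredD //; apply: zspan_gen; exact: LinAll uA.
move=> w wA; rewrite !ffunE LE // KE //; have := face_total fA uA wA.
have [->|wu] := eqVneq w u; first by rewrite vle_refl addrK.
have [uw _|nuw /= ->] := boolP (vle u w); last by rewrite add0r subrr.
by case: (boolP (vle w u)) => [/vle_anti/(_ uw)/eqP|]; rewrite ?(negbTE wu) // addr0 subrr.
Qed.

End ProductComplex.

(** * The Chow ring *)

Section Chow.

Variables (d : nat) (disp : Order.disp_t).
Variables (V : 'I_d -> finOrderType disp) (E : forall i, rel (V i)).

Implicit Types (u v w x y : vertex V) (s : seq (vertex V)) (A B : {set vertex V}).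
Local Notation mon := 'X_{1..#|vertex V|}.
Local Notation ZG := (ZG V).
Local Notation rat := (rat_ideal E).

Definition mseq s : mon := (\sum_(v <- s) mvar v)%MM.

Lemma Csimplex_mseq s : Csimplex s = 'X_[mseq s] :> ZG.
Proof.
rewrite /Csimplex /mseq; elim: s => [|v s IH]; first by rewrite !big_nil mpolyX0.
by rewrite !big_cons IH mpolyXD.
Qed.

Lemma msupport_mseq s : msupport (mseq s) = [set v in s].
Proof.
rewrite /mseq; elim: s => [|v s IH]; first by apply/setP => v; rewrite big_nil !inE mnm0E.
by rewrite big_cons msupportD IH msupport_mvar; apply/setP => w; rewrite !inE.
Qed.

Lemma mdeg_mseq s : mdeg (mseq s) = size s.
Proof. by rewrite mdeg_sum; under eq_bigr do rewrite mdeg1; rewrite sum1_size. Qed.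

Lemma mdefect_mseq s : uniq s -> mdefect (mseq s) = 0%N.
Proof.
move=> us; apply/eqP; rewrite -(eqn_add2l #|msupport (mseq s)|) -mdeg_defect addn0.
by rewrite mdeg_mseq msupport_mseq cardsE; apply/eqP/esym/card_uniqP.
Qed.

Lemma mseq_surj (m : mon) : exists s, m = mseq s.
Proof.
have [n] := ubnP (mdeg m); elim: n m => // n IH m dm.
have [->|m0] := eqVneq m 0%MM; first by exists [::]; rewrite /mseq big_nil.
have [i mi] : exists i, m i != 0%N.
  apply/existsP; apply: contraR m0; rewrite negb_exists => /forallP m0.
  by apply/eqP/mnmP => i; rewrite mnm0E; apply/eqP; rewrite -[_ == _]negbK m0.
have mE : m = (m - mvar (enum_val i) + mvar (enum_val i))%MM.
  rewrite submK //; apply/mnm_lepP => j; rewrite /mvar enum_valK mnm1E.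
  by case: eqP => // <-; rewrite lt0n.
have [|s sE] := IH (m - mvar (enum_val i))%MM; first by move: dm; rewrite {1}mE mdeg_addvar.
by exists (enum_val i :: s); rewrite mE sE /mseq big_cons addmC.
Qed.

Lemma mdefect0_inj (m1 m2 : mon) : mdefect m1 = 0%N -> mdefect m2 = 0%N ->
  msupport m1 = msupport m2 -> m1 = m2.
Proof.
have mE (m : mon) v : mdefect m = 0%N -> m (enum_rank v) = (v \in msupport m).
  move=> /eqP; rewrite sum_nat_eq0 => /forallP/(_ v) /=; rewrite inE.
  by case: (m _) => [|[|]].
move=> m1d m2d ms; apply/mnmP => i.
by rewrite -[i]enum_valK !mE // ms.
Qed.

(** * Elements of the Chow ideal and reduction of monomials *)

Lemma Csimplex_rem s u : u \in s -> Csimplex s = Cvar u * Csimplex (rem u s).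
Proof. by move=> us; rewrite /Csimplex (big_rem u). Qed.

Lemma rat_idealM (a p : ZG) : p \in rat -> a * p \in rat.
Proof. exact: ideal_span_mul. Qed.

Lemma rat_ideal_gen (p : ZG) : rat_gen E p -> p \in rat.
Proof.
move=> pg; apply/ideal_spanP; exists [:: (1, p)]; split.
  by move=> q; rewrite inE => /eqP->.
by rewrite big_seq1 mul1r.
Qed.

Lemma rat_nonface s : ~~ face E [set x in s] -> Csimplex s \in rat.
Proof.
have [->|s0] := eqVneq s [::]; last first.
  by move=> fs; apply/rat_ideal_gen/R1 => // /(forms_simplexP _ s0); apply/negP.
case/negP; apply/faceP.
by split=> [u v|u v w i]; rewrite inE in_nil.
Qed.

Lemma rat_lin s L : L \in zspan (lin_gen [set x in s]) ->
  Csimplex s * \sum_v Cvar v *~ L v \in rat.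
Proof.
case/zspanP=> t [tS ->]; elim: t tS => [|[c g] t IH] tS.
  rewrite big_nil big1 ?mulr0 ?rpred0 // => v _.
  by rewrite ffunE mulr0z.
have -> : \sum_v Cvar v *~ (\sum_(p <- (c, g) :: t) p.2 *~ p.1 : {ffun vertex V -> int}) v =
    (\sum_v Cvar v *~ g v) *~ c +
    \sum_v Cvar v *~ (\sum_(p <- t) p.2 *~ p.1 : {ffun vertex V -> int}) v.
  rewrite mulrz_suml -big_split; apply: eq_bigr => v _ /=.
  by rewrite big_cons ffunE mulrzDr ffunMzE mulrzz mulrzA.
rewrite mulrDr rpredD //; last by apply: IH => p pt; apply: tS; rewrite inE pt orbT.
rewrite -mulrzr mulrA mulrzr rpredMz //.
have /= := tS (c, g) (mem_head _ _) => -[u|u v i]; rewrite ?inE => us.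
  rewrite (eq_bigr (@Cvar d disp V)) => [|v _]; last by rewrite ffunE mulr1z.
  rewrite (Csimplex_rem us) mulrAC mulrC; apply: rat_idealM.
  exact/rat_ideal_gen/R2.
move=> vs uv; have vs' : v \in rem u s.
  have := perm_mem (perm_to_rem us) v; rewrite vs inE => /esym/predU1P[vu|//].
  by rewrite vu eqxx in uv.
rewrite (Csimplex_rem us) (Csimplex_rem vs').
rewrite (_ : \sum_w _ = \sum_(w : vertex V | w i == u i) Cvar w); last first.
  rewrite [RHS]big_mkcond; apply: eq_bigr => w _; rewrite ffunE.
  by case: eqP => _; rewrite ?mulr1z ?mulr0z.
rewrite mulrA mulrAC mulrC; apply: rat_idealM.
exact/rat_ideal_gen/R3.
Qed.

(** [Rtilde] is the difference L of two R3 forms cut down to the cube. Outside the cube a vertex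
    either leaves the star, where R1 applies, or has coefficient 0 in L by [star_cube]. *)
Lemma rat_nd_rel k p : nd_rel E k p -> p \in rat.
Proof.
case=> k' s s1 s2 u v i j _ /nd_simplexP[_ fs so] sE iuv juv.
set A := [set x in s] in fs.
have uvA : consecutive A u v.
  by rewrite /A sE; apply: chain_consecutive; rewrite -sE.
have [uA vA _ _] := uvA.
pose L := [ffun w : vertex V => (w i == u i)%:R - (w j == u j)%:R : int].
have LL : L \in zspan (lin_gen A).
  rewrite (_ : L = [ffun w : vertex V => (w i == u i)%:R] -
                   [ffun w : vertex V => (w j == u j)%:R]); last first.
    by apply/ffunP => w; rewrite !ffunE.
  move: iuv juv; rewrite !inE => iuv juv.
  by rewrite rpredB //; apply: zspan_gen; apply: (LinCoord uA vA); rewrite lt_eqF.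
have RE : Rtilde u v i j = \sum_(w in cube u v) Cvar w *~ L w.
  rewrite /Rtilde [X in X - _]big_mkcondr [X in _ - X]big_mkcondr -sumrB.
  apply: eq_bigr => w _; rewrite ffunE mulrzBr.
  by congr (_ - _); case: eqP => _; rewrite ?mulr1z ?mulr0z.
have := rat_lin LL; rewrite (bigID (mem (cube u v))) /= -RE mulrDr => H.
rewrite -[X in X \in _](addrK (Csimplex s * \sum_(w | w \notin cube u v) Cvar w *~ L w)).
rewrite rpredB // mulr_sumr rpred_sum // => w wc; rewrite -mulrzr mulrA mulrzr.
have [fw|fw] := boolP (face E (w |: A)).
  by rewrite ffunE (star_cube fw uvA iuv juv wc) subrr mulr0z rpred0.
rewrite rpredMz // mulrC (_ : _ * _ = Csimplex (w :: s)); last first.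
  by rewrite /Csimplex big_cons.
apply: rat_nonface; apply: contra fw; congr (face E _).
by apply/setP => x; rewrite !inE.
Qed.

Lemma rat_I_nd k (p : Znd E k) : p \in I_nd E k -> val p \in rat.
Proof.
case/zspanP=> s [sS ->]; rewrite raddf_sum big_seq rpred_sum // => q qs.
by rewrite raddfMz rpredMz //; apply: rat_nd_rel (sS q qs).
Qed.

Lemma nd_monomial_mdefect k (m : mon) : mdeg m = k.+1 -> face E (msupport m) ->
  mdefect m = 0%N -> nd_monomial E k ('X_[m] : ZG).
Proof.
move=> dm fm m0; have [s [sE so sz]] := face_chain fm.
have us : uniq s by move: so; rewrite vlt_sorted => /andP[].
have -> : m = mseq s by apply: mdefect0_inj; rewrite ?mdefect_mseq ?msupport_mseq.
rewrite -Csimplex_mseq; apply: NdMonomial; apply/nd_simplexP; split=> //.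
  by rewrite sz -dm mdeg_defect m0 addn0.
by rewrite -sE.
Qed.

(** Induction on the defect: for a repeated [u], the form of [lin_delta] rewrites the monomial,
    modulo the ideal, through monomials in which one [u] is replaced by a vertex outside the
    support. *)
Lemma mpolyX_nd_span k (m : mon) : mdeg m = k.+1 ->
  'X_[m] \in zspan (fun p : ZG => nd_monomial E k p \/ p \in rat).
Proof.
move: {2}(mdefect m) (erefl (mdefect m)) => j; elim: j m => [|j IH] m jm dm.
  have [fm|fm] := boolP (face E (msupport m)).
    by apply: zspan_gen; left; apply: nd_monomial_mdefect.
  have [s sE] := mseq_surj m; apply: zspan_gen; right.
  by rewrite sE -Csimplex_mseq; apply: rat_nonface; rewrite -msupport_mseq -sE.
have [fm|fm] := boolP (face E (msupport m)); last first.
  have [s sE] := mseq_surj m; apply: zspan_gen; right.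
  by rewrite sE -Csimplex_mseq; apply: rat_nonface; rewrite -msupport_mseq -sE.
have [u mu] : exists u, (1 < m (enum_rank u))%N by apply: mdefect_gt0; rewrite jm.
have [m' mE um'] := mvar_split mu; rewrite {}mE in jm dm fm *.
rewrite mdefect_addvar um' add1n in jm; case: jm => jm.
rewrite msupport_addvar_in // in fm.
have [L LL LE] := lin_delta fm um'; have [s sE] := mseq_surj m'.
have := @rat_lin s L; rewrite -msupport_mseq Csimplex_mseq -sE => /(_ LL).
rewrite mulr_sumr (bigID (mem (msupport m'))) /= (bigD1 u) //= LE // eqxx mulr1z.
rewrite big1 => [|v /andP[vm vu]]; last by rewrite LE // (negbTE vu) mulr0z mulr0.
rewrite addr0 -mpolyXD => Irat.
rewrite -[X in X \in _](addrK (\sum_(v | v \notin msupport m') 'X_[m'] * (Cvar v *~ L v))).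
rewrite rpredB //; first by apply: zspan_gen; right.
apply: rpred_sum => v vm; rewrite -mulrzr mulrA mulrzr rpredMz // -mpolyXD.
apply: IH; first by rewrite mdefect_addvar (negbTE vm).
by rewrite mdeg_addvar -dm mdeg_addvar.
Qed.

Lemma homog_nd_span k (p : {mpoly int[#|vertex V|]}) : p \is k.+1.-homog ->
  exists q : Znd E k, (p : ZG) - val q \in rat.
Proof.
move=> /dhomogP hp.
have /zspan_orP[q qS pq] : (p : ZG) \in zspan (fun p : ZG => nd_monomial E k p \/ p \in rat).
  rewrite (mpolyE p) big_seq rpred_sum // => m mp.
  by rewrite -[p@_m]intz scaler_int rpredMz // mpolyX_nd_span // (hp _ mp).
by exists (MkZnd qS).
Qed.

Lemma Znd_homog k (p : Znd E k) : (val p : {mpoly int[#|vertex V|]}) \is k.+1.-homog.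
Proof.
have /zspanP[s [sS ->]] := valP p; rewrite big_seq rpred_sum // => q qs.
rewrite rpredMz //; have [t /nd_simplexP[st _ _]] := sS q qs.
by rewrite Csimplex_mseq dhomogX /= mdeg_mseq st.
Qed.

(** * The reduction map to the quotient by I_k^nd *)

Section NdClass.

Variable k : nat.
Local Notation Q := (nd_quot E k).

(* Total on Z(G): junk value 0 outside Z<G_k^nd>. *)
Definition nd_class (p : ZG) : Q := \pi_Q (insubd (0 : Znd E k) p).

Lemma nd_class_val (p : Znd E k) : nd_class (val p) = \pi_Q p.
Proof. by rewrite /nd_class valKd. Qed.

Lemma nd_class_sum (I : Type) (r : seq I) (P : pred I) (F : I -> ZG) :
  (forall i, P i -> F i \in zspan (nd_monomial E k)) ->
  nd_class (\sum_(i <- r | P i) F i) = \sum_(i <- r | P i) nd_class (F i).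
Proof.
move=> FS; have -> : \sum_(i <- r | P i) F i =
    val (\sum_(i <- r | P i) insubd (0 : Znd E k) (F i)).
  rewrite raddf_sum; apply: eq_bigr => i Pi.
  by have /esym := val_insubd (0 : Znd E k) (F i); rewrite FS.
by rewrite nd_class_val raddf_sum.
Qed.

Lemma nd_classB (p q : ZG) :
  p \in zspan (nd_monomial E k) -> q \in zspan (nd_monomial E k) ->
  nd_class (p - q) = nd_class p - nd_class q.
Proof.
move=> pS qS; rewrite -[p]/(val (MkZnd pS)) -[q]/(val (MkZnd qS)).
by rewrite -raddfB !nd_class_val raddfB.
Qed.

Lemma nd_classMz (p : ZG) (n : int) :
  p \in zspan (nd_monomial E k) -> nd_class (p *~ n) = nd_class p *~ n.
Proof.
move=> pS; rewrite -[p]/(val (MkZnd pS)).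
by rewrite -raddfMz !nd_class_val raddfMz.
Qed.

Lemma nd_class_rel (p : ZG) : nd_rel E k p -> nd_class p = 0.
Proof.
move=> pR; have pS := nd_rel_Znd pR; rewrite -[p]/(val (MkZnd pS)) nd_class_val.
apply/eqP; rewrite -(raddf0 (\pi_Q)) -Quotient.idealrBE subr0.
exact: zspan_gen.
Qed.

(** The instance of [psi0] used for the reduction map. *)
Definition nd_face A : Q := nd_class (\prod_(v in A) Cvar v).

Lemma nd_faceE s : uniq s -> nd_face [set v in s] = nd_class (Csimplex s).
Proof.
move=> us; congr nd_class; rewrite /Csimplex [RHS](big_uniq _ us) /=.
by apply: eq_bigl => v; rewrite inE.
Qed.

Lemma nd_face_rel k' s1 u v s2 i j : k = k'.+1 ->
    nd_simplex E k' (s1 ++ [:: u, v & s2]) -> i \in dirs u v -> j \in dirs u v ->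
  let A := [set x in s1 ++ [:: u, v & s2]] in
  \sum_(w | (w \in cube u v) && (w i == u i) && (w != u)) nd_face (w |: A) =
  \sum_(w | (w \in cube u v) && (w j == u j) && (w != u)) nd_face (w |: A).
Proof.
move=> kE sk iuv juv A; pose s := s1 ++ [:: u, v & s2].
have cu l : (u \in cube u v) && (u l == u l).
  by rewrite eqxx andbT inE; apply/forallP => m; rewrite eqxx.
have us : uniq s.
  by case/nd_simplexP: sk => _ _; rewrite vlt_sorted => /andP[].
have wE l w : l \in dirs u v -> (w \in cube u v) && (w l == u l) && (w != u) ->
    Csimplex s * Cvar w \in zspan (nd_monomial E k) /\
    nd_class (Csimplex s * Cvar w) = nd_face (w |: A).
  move=> luv /andP[/andP[wc wl] wu].
  have nds := nd_simplex_refine sk wc wu luv wl.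
  have us' : uniq (s1 ++ [:: u, w, v & s2]).
    by have /nd_simplexP[_ _] := nds; rewrite vlt_sorted => /andP[].
  have -> : Csimplex s * Cvar w = Csimplex (s1 ++ [:: u, w, v & s2]).
    by rewrite /s /Csimplex !big_cat !big_cons /= -!mulrA; congr (_ * (_ * _)); rewrite mulrA mulrC.
  split; first by apply: zspan_gen; rewrite kE; apply: NdMonomial.
  rewrite -nd_faceE //; congr nd_face; apply/setP => x.
  by rewrite !inE !mem_cat !inE; do !case: (_ == _); rewrite ?orbT.
have := nd_class_rel (NdRel kE sk erefl iuv juv).
(* The term w = u, which would repeat a vertex of the simplex, occurs in both sums and cancels. *)
rewrite /Rtilde (bigD1 u) ?cu // [X in _ - X](bigD1 u) ?cu //= opprD addrACA subrr add0r.
rewrite mulrBr !mulr_sumr nd_classB; last first.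
- by apply: rpred_sum => w /(wE _ _ juv)[].
- by apply: rpred_sum => w /(wE _ _ iuv)[].
rewrite !nd_class_sum; last first.
- by move=> w /(wE _ _ iuv)[].
- by move=> w /(wE _ _ juv)[].
move/eqP; rewrite subr_eq0 => /eqP H.
rewrite (eq_bigr _ (fun w Pw => esym (wE i w iuv Pw).2)) H.
by apply: eq_bigr => w Pw; rewrite (wE j w juv Pw).2.
Qed.

Lemma nd_face_ker A L : face E A -> #|A| = k -> L \in zspan (lin_gen A) ->
    (forall v, v \in A -> L v = 0) ->
  \sum_(w | (w \notin A) && face E (w |: A)) nd_face (w |: A) *~ L w = 0.
Proof.
move=> fA Ak LL L0.
pose q w : Q := if face E (w |: A) then nd_face (w |: A) else 0.
have <- : \sum_(w | w \notin A) q w *~ L w =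
    \sum_(w | (w \notin A) && face E (w |: A)) nd_face (w |: A) *~ L w.
  rewrite big_mkcondr; apply: eq_bigr => w _; rewrite /q.
  by case: ifP; rewrite ?mul0rz.
apply: (lin_gen_ker fA LL L0) => [w wA fw|]; first by rewrite /q (negbTE fw).
move=> s1 u v s2 i j AE so sz iuv juv; set s := s1 ++ _ in AE so sz.
have uvA : consecutive A u v by rewrite AE; apply: chain_consecutive.
have [uA vA /andP[_ /vleP uv] tot] := uvA.
have [k' kE] : exists k', k = k'.+1.
  by exists (size s1 + size s2).+1; rewrite -Ak -sz size_cat /= addnS addnS.
have nds : nd_simplex E k' s by apply/nd_simplexP; rewrite sz Ak -AE.
(* Inside the cube these sums are compared by the relation of I_k^nd; outside it, the terms for [i]
   and [j] agree one by one by [star_cube]. *)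
have split_cube l : l \in dirs u v ->
    \sum_(w : vertex V | w \notin A) q w *~ (w l == u l)%:R =
    \sum_(w | (w \in cube u v) && (w l == u l) && (w != u)) nd_face (w |: A) +
    \sum_(w | (w \notin A) && (w \notin cube u v)) q w *~ (w l == u l)%:R.
  move=> luv; rewrite (bigID (mem (cube u v))) /=; congr (_ + _).
  rewrite big_mkcond [RHS]big_mkcond; apply: eq_bigr => w _ /=.
  have [wc|_] := boolP (w \in cube u v); last by rewrite andbF.
  have [wl|_] := boolP (w l == u l); last by rewrite mulr0z if_same.
  rewrite andbT /= mulr1z; have [->|wu] := eqVneq w u; first by rewrite uA.
  have nds' := nd_simplex_refine nds wc wu luv wl.
  have fw : face E (w |: A).
    have /nd_simplexP[_ + _] := nds'; congr (face E _); apply/setP => x.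
    by rewrite AE !inE !mem_cat !inE; do !case: (_ == _); rewrite ?orbT.
  (* Such a [w] lies strictly between the consecutive vertices [u] and [v], so it is not in [A]. *)
  rewrite /q fw ifT //; apply/negP => /tot/orP[/vleP wu'|/vleP vw].
    case/eqP: wu; apply: vle_anti; first exact/vleP.
    apply/vleP => m; move: wc; rewrite inE => /forallP/(_ m)/orP[] /eqP-> //.
  by move: (vw l); rewrite (eqP wl) leNgt; rewrite inE in luv; rewrite luv.
rewrite !split_cube //; congr (_ + _); last first.
  apply: eq_bigr => w /andP[wA wc].
  have [fw|fw] := boolP (face E (w |: A)); last by rewrite /q (negbTE fw) !mul0rz.
  by rewrite (star_cube fw uvA iuv juv wc).
by rewrite AE; apply: (nd_face_rel kE nds iuv juv).
Qed.

(** Supplies injectivity of the isomorphism: a map that kills the ideal and restricts to the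
    quotient map on Z<G_k^nd>. *)
Lemma nd_class_extends : exists Psi : ZG -> Q,
  (forall p, p \in rat -> Psi p = 0) /\ forall p : Znd E k, Psi (val p) = \pi_Q p.
Proof.
(* The conditions on the pair sit inside [P] so that choice gives a total function; pairs violating
   them receive 0. *)
pose P (Au : {set vertex V} * vertex V) L := face E Au.1 -> Au.2 \in Au.1 ->
  L \in zspan (lin_gen Au.1) /\ forall w, w \in Au.1 -> L w = (w == Au.2)%:R.
have [lift liftP] : {lift & forall Au, P Au (lift Au)}.
  apply: boolp.choice => -[A u]; rewrite /P /=.
  have [fA|] := boolP (face E A); last by exists 0.
  have [uA|] := boolP (u \in A); last by exists 0.
  by have [L LL LE] := lin_delta fA uA; exists L.
pose l A u := lift (A, u).
have lL A u : face E A -> u \in A -> l A u \in zspan (lin_gen A).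
  by move=> fA uA; have [] := liftP (A, u) fA uA.
have lE A u v : face E A -> u \in A -> v \in A -> l A u v = (v == u)%:R.
  by move=> fA uA; have [_] := liftP (A, u) fA uA; apply.
pose Psi : {additive {mpoly int[#|vertex V|]} -> Q} := psi_ext (face E) nd_face k l.
have PsiX s L : L \in zspan (lin_gen [set x in s]) ->
    Psi (Csimplex s * \sum_v Cvar v *~ L v) = 0.
  rewrite -msupport_mseq Csimplex_mseq => LL.
  exact: (psi_ext_lin (@faceS _ _ _ E) (@lin_genS _ _ V) lL lE nd_face_ker LL).
exists Psi; split=> [p /ideal_spanP[t [tS ->]]|p]; last first.
  have /zspanP[t [tS pE]] := valP p; rewrite -nd_class_val pE.
  rewrite big_seq_cond raddf_sum nd_class_sum => [|c /andP[ct _]]; last first.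
    by rewrite rpredMz // zspan_gen //; apply: tS.
  apply: eq_bigr => c /andP[ct _]; have cS := tS c ct.
  rewrite raddfMz nd_classMz ?zspan_gen //; congr (_ *~ _).
  case: cS => s /nd_simplexP[sk fs]; rewrite vlt_sorted => /andP[us _].
  rewrite {1}Csimplex_mseq /= /Psi psi_extX mdeg_mseq sk eqxx.
  by rewrite psi_squarefree ?msupport_mseq ?mdefect_mseq // nd_faceE.
rewrite raddf_sum big_seq big1 // => -[a g] /tS /= gS.
(* Expanding the coefficient [a] into monomials leaves products of one monomial with one
   generator. *)
rewrite (mpolyE a) mulr_suml raddf_sum big1 // => m _.
rewrite -[a@_m]intz scaler_int -mulrzl -mulrA mulrzl raddfMz.
suff -> : Psi ('X_[m] * g) = 0 by rewrite mul0rz.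
have [s ->] := mseq_surj m; rewrite -Csimplex_mseq.
have catE s' : Csimplex s * Csimplex s' = Csimplex (s ++ s') by rewrite /Csimplex big_cat.
case: gS => [t' t0 nt|u|u w i uw].
- rewrite catE Csimplex_mseq /Psi /= psi_extX psi_nonface ?if_same //.
  rewrite msupport_mseq; apply/negP => fs; apply: nt; apply/(forms_simplexP _ t0).
  by apply: faceS fs; apply/subsetP => x; rewrite !inE mem_cat => ->; rewrite orbT.
- have -> : Cvar u * \sum_v Cvar v =
      Csimplex [:: u] * \sum_v Cvar v *~ ([ffun=> 1] : {ffun vertex V -> int}) v.
    rewrite /Csimplex big_seq1; congr (_ * _).
    by apply: eq_bigr => v _; rewrite ffunE.
  rewrite mulrA catE PsiX //; apply: zspan_gen; apply: (LinAll (u := u)).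
  by rewrite inE mem_cat mem_head orbT.
- have -> : Cvar u * Cvar w * \sum_(v : vertex V | v i == u i) Cvar v =
      Csimplex [:: u; w] *
      \sum_v Cvar v *~ ([ffun v : vertex V => (v i == u i)%:R] : {ffun vertex V -> int}) v.
    rewrite /Csimplex big_cons big_seq1; congr (_ * _).
    rewrite [LHS]big_mkcond; apply: eq_bigr => v _; rewrite ffunE.
    by case: eqP; rewrite ?mulr1z ?mulr0z.
  rewrite mulrA catE PsiX //; apply: zspan_gen; apply: (LinCoord (u := u) (v := w)) => //.
    by rewrite inE mem_cat !inE eqxx orbT.
  by rewrite inE mem_cat !inE eqxx !orbT.
Qed.

End NdClass.

End Chow.

(** * The isomorphism *)

Theorem theorem1p5 (d : nat) (hd : (0 < d)%N) (disp : Order.disp_t)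
    (V : 'I_d -> finOrderType disp) (E : forall i, rel (V i))
    (hE : forall i, simple_connected_graph (E i)) (k : nat) :
  exists f : {additive nd_quot E k -> chow_part E k.+1},
    bijective f /\
    forall x : Znd E k,
      val (f (\pi_(nd_quot E k) x)) = \pi_(Chow E) (val x).
Proof.
have gP (x : Znd E k) : \pi_(Chow E) (val x) \in chow_homog (E := E) k.+1.
  by apply/asboolP; exists (val x); [exact: Znd_homog|].
(* Defined on the chosen representative; [fE] then gives independence of it, since I_k^nd lies in
   the Chow ideal. *)
pose f (q : nd_quot E k) : chow_part E k.+1 := ChowPart (gP (repr q)).
have fE (x : Znd E k) : val (f (\pi_(nd_quot E k) x)) = \pi_(Chow E) (val x).
  apply/eqP; rewrite -Quotient.idealrBE -raddfB; apply: rat_I_nd.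
  by rewrite Quotient.idealrBE reprK.
have f_additive : zmod_morphism f.
  elim/quotW => x; elim/quotW => y; rewrite -raddfB; apply: val_inj.
  by rewrite fE [RHS]raddfB !raddfB; congr (_ - _); exact/esym/fE.
have f_inj : injective f.
  elim/quotW => x; elim/quotW => y /(congr1 val); rewrite !fE => /eqP.
  rewrite -Quotient.idealrBE -raddfB => xy.
  (* The difference x - y lies in the ideal, so [Psi] sends it to 0, while [PsiE] identifies this
     value with its class. *)
  have [Psi [Psi0 PsiE]] := nd_class_extends E k.
  have: \pi_(nd_quot E k) (x - y) = 0 by rewrite -PsiE Psi0.
  by rewrite raddfB => /subr0_eq.
(* Surjectivity: reducing a homogeneous representative gives a preimage, and choice assembles these
   into a right inverse. *)
have [g gK] : {g & forall y, f (g y) = y}.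
  apply: (@boolp.choice _ _ (fun y q => f q = y)) => -[y yh].
  have /asboolP[p hp yE] := yh; have [q pq] := homog_nd_span E hp.
  exists (\pi_(nd_quot E k) q); apply: val_inj; rewrite fE /= yE.
  by apply/esym/eqP; rewrite -Quotient.idealrBE.
pose F : {additive nd_quot E k -> chow_part E k.+1} :=
  HB.pack f (GRing.isZmodMorphism.Build _ _ f f_additive).
exists F; split=> //; exists g => // q; exact: f_inj (gK (f q)).
Qed.
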